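(* In the linear regression model with Huber loss described in the context, let $s\geqslant1$ be an integer and suppose that: (a) $\|f_{\theta^*}\|_\infty\leqslant K$; (b) (mutual coherence) the Gram matrix $G=(\mathbb{E}[f_j(X)f_k(X)])_{1\leqslant j,k\leqslant M}$ satisfies $G_{j,j}=1$ for all $j$ and $\max_{j\neq k}|G_{j,k}|\leqslant\frac{1}{3\beta s}$ for a constant $\beta>1$; (c) the c.d.f. of $W$ is Lipschitz continuous with constant $1$; (d) $s\leqslant 1/\sqrt r$; (e) $12L^3\eta+L\tilde r+\frac{C_2}{\sqrt n\,s^2}\leqslant\frac{\mathbb{P}(|W|\leqslant2K+\alpha)}{2}$; (f) $\rho:=\min_{j\in J(\theta^* )}|\theta^*_j|>2C_4r$. If $M(\theta^* )\leqslant s$, then $$\mathbb{P}\left(\vec{\mathrm{sign}}(\tilde\theta)=\vec{\mathrm{sign}}(\theta^* )\ \ \forall\,\tilde\theta\in\tilde\Theta\right)\geqslant1-M^{-1}-M^{-K}-\exp(-\sqrt{\log M})-3M^{-2K}\log\frac{n}{\log M}.$$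
   Context: Model: $Y=f_{\theta^*}(X)+W$, where $X$ is a random vector in $\mathbb{R}^d$, $W$ is a real random variable independent of $X$ with distribution symmetric about $0$, and $\theta^*\in\mathbb{R}^M$ is unknown; $(X_i,Y_i)$, $i=1,\ldots,n$, are i.i.d. copies of $(X,Y)$. For $g:\mathbb{R}^d\to\mathbb{R}$, $\|g\|_\infty$ is the essential supremum of $|g|$ and $\|g\|=(\mathbb{E}\,g(X)^2)^{1/2}$. The dictionary $f_1,\ldots,f_M$ ($M\geqslant2$) satisfies $\|f_j\|=1$, $\|f_j\|_\infty\leqslant L$ with $L>0$. For $\theta\in\mathbb{R}^M$: $f_\theta=\sum_j\theta_jf_j$, $J(\theta)=\{j:\theta_j\neq0\}$, $M(\theta)=|J(\theta)|$, and $\vec{\mathrm{sign}}(\theta)=(\mathrm{sign}(\theta_1),\ldots,\mathrm{sign}(\theta_M))^T$ with $\mathrm{sign}(t)=1,0,-1$ for $t>0$, $t=0$, $t<0$ respectively; $|\cdot|_1$, $|\cdot|_\infty$ are the $l_1$ and sup norms of vectors. Loss: for constants $K>0$, $\alpha>0$, let $\phi(x)=\frac12x^2$ if $|x|\leqslant2K+\alpha$ and $\phi(x)=(2K+\alpha)|x|-\frac{(2K+\alpha)^2}{2}$ otherwise. Put $Q(z,\theta)=\phi(y-f_\theta(x))$ for $z=(x,y)$ and $\hat R_n(\theta)=\frac1n\sum_iQ((X_i,Y_i),\theta)$. Parameters: $\tilde r=4\sqrt2\,L\frac{\log M}{n}+2\sqrt6\sqrt{\frac{\log M}{n}}$, assumed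 $\leqslant1$; $r=6\|\phi'\|_\infty\tilde r=6(2K+\alpha)\tilde r$. It is assumed that $\mathbb{P}(|W|\leqslant\alpha)>0$. Further, $$C_1=\frac{8(1+2K)\beta}{\mathbb{P}(|W|\leqslant\alpha)(\beta-1)}+\frac16,\qquad \eta=C_1rs,$$ $$C_2=2\sqrt{1+(1+L^2)\Big(8C_1L^3+\frac{4L}{s}\Big)}+\frac{1+L^2}{3},\qquad C_3=\frac{1}{3\beta}+12L^3C_1+\frac{C_2}{\sqrt n\,s},\qquad C_4=\frac{4+2C_1C_3}{\mathbb{P}(|W|\leqslant2K+\alpha)}.$$ Estimators: $\Theta=\{\theta\in\mathbb{R}^M:\|f_\theta\|_\infty\leqslant K\}$, and $\hat\Theta$ is the (random) set of all solutions of: minimize $|\theta|_1$ over $\theta\in\Theta$ subject to $|\nabla\hat R_n(\theta)|_\infty\leqslant r$. For each $\hat\theta\in\hat\Theta$ the thresholded estimator $\tilde\theta\in\mathbb{R}^M$ is defined by $\tilde\theta_j=\hat\theta_j$ if $|\hat\theta_j|>C_4r$ and $\tilde\theta_j=0$ otherwise; $\tilde\Theta$ is the set of all such $\tilde\theta$. *)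

(* Defs.v *)
From HB Require Import structures.
From mathcomp Require Import all_boot all_order all_algebra.
From mathcomp Require Import all_classical all_reals all_analysis.

Set Implicit Arguments.
Unset Strict Implicit.
Unset Printing Implicit Defensive.

Import Order.TTheory GRing.Theory Num.Theory.
Import numFieldNormedType.Exports.

Local Open Scope classical_set_scope.
Local Open Scope ring_scope.

Section random_variables.
Context {dO : measure_display} {Omega : measurableType dO} {R : realType}.
Variable P : probability Omega R.
Local Open Scope ereal_scope.

Definition independent_rv {d1 d2 : measure_display} {T1 : measurableType d1}
    {T2 : measurableType d2} (U : Omega -> T1) (V : Omega -> T2) : Prop :=
  forall (A : set T1) (B : set T2), measurable A -> measurable B ->
    P (U @^-1` A `&` V @^-1` B) = P (U @^-1` A) * P (V @^-1` B).

Definition mutually_independent {d1 : measure_display} {T1 : measurableType d1}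
    {I : finType} (Z : I -> Omega -> T1) : Prop :=
  forall (J : {set I}) (A : I -> set T1), (forall i, measurable (A i)) ->
    P (\bigcap_(i in [set` J]) (Z i @^-1` A i))
    = \prod_(i in J) P (Z i @^-1` A i).

Definition same_law {d1 : measure_display} {T1 : measurableType d1}
    (U V : Omega -> T1) : Prop :=
  forall A : set T1, measurable A -> P (U @^-1` A) = P (V @^-1` A).

Definition iid_copies {d1 : measure_display} {T1 : measurableType d1}
    {I : finType} (Z : I -> Omega -> T1) (V : Omega -> T1) : Prop :=
  mutually_independent Z /\ forall i, same_law (Z i) V.

Definition symmetric_rv (W : Omega -> R) : Prop :=
  same_law W (fun w => (- W w)%R).

Definition prob_abs_le (W : Omega -> R) (t : R) : R :=
  fine (P [set w | (`|W w| <= t)%R]).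

End random_variables.

Section vectors.
Context {R : realType} {M : nat}.
Implicit Types theta : 'rV[R]_M.

Definition l1norm theta : R := \sum_(j < M) `|theta 0 j|.

Definition sign_vec theta : 'rV[R]_M := map_mx Num.sg theta.

Definition supp theta : {set 'I_M} := [set j | theta 0 j != 0]%SET.

(* +oo when theta = 0, as the minimum over the empty set. *)
Definition min_abs_supp theta : \bar R :=
  \big[Order.min/+oo%E]_(j in supp theta) (`|theta 0 j|%:E)%E.

Definition grad (F : 'rV[R]_M -> R) theta : 'rV[R]_M :=
  \row_(j < M) ('D_(delta_mx 0 j) F theta).

Definition threshold (t : R) theta : 'rV[R]_M :=
  \row_(j < M) (if t < `|theta 0 j| then theta 0 j else 0).

End vectors.

Section dictionary.
Context {R : realType} {d M : nat}.
Variable f : 'I_M -> {mfun d.-tuple R >-> R}.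

Definition lincomb (theta : 'rV[R]_M) (x : d.-tuple R) : R :=
  \sum_(j < M) theta 0 j * f j x.

Definition Gram {dO : measure_display} {Omega : measurableType dO}
    {P : probability Omega R} (X : {RV P >-> d.-tuple R}) : 'M[R]_M :=
  \matrix_(j < M, k < M) fine ('E_P[fun w => (f j (X w) * f k (X w))%R])%E.

End dictionary.

(* The norms of g(X), for a function g of the random vector X. *)
Section norms.
Context {dO : measure_display} {Omega : measurableType dO} {R : realType}.
Context {P : probability Omega R} {d : nat}.
Variable X : {RV P >-> d.-tuple R}.

Definition norm_infty (g : d.-tuple R -> R) : \bar R :=
  ('N[distribution P X]_+oo [EFin \o g])%E.

Definition norm_2 (g : d.-tuple R -> R) : \bar R :=
  ('N[distribution P X]_2%:E [EFin \o g])%E.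

End norms.

Section huber.
Context {R : realType}.
Variables K alpha : R.

Definition huber (x : R) : R :=
  if `|x| <= 2 * K + alpha then x ^+ 2 / 2
  else (2 * K + alpha) * `|x| - (2 * K + alpha) ^+ 2 / 2.

Context {d M : nat}.
Variable f : 'I_M -> {mfun d.-tuple R >-> R}.

Definition Qloss (z : d.-tuple R * R) (theta : 'rV[R]_M) : R :=
  huber (z.2 - lincomb f theta z.1).

Definition emp_risk {n : nat} (z : 'I_n -> d.-tuple R * R)
    (theta : 'rV[R]_M) : R :=
  n%:R^-1 * \sum_(i < n) Qloss (z i) theta.

Context {dO : measure_display} {Omega : measurableType dO}.
Context {P : probability Omega R}.
Variable X : {RV P >-> d.-tuple R}.

Definition Theta : set 'rV[R]_M :=
  [set theta | (norm_infty X (lincomb f theta) <= K%:E)%E].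

(* The norm of 'rV[R]_M is the sup norm. *)
Definition feasible {n : nat} (r : R) (z : 'I_n -> d.-tuple R * R) :
    set 'rV[R]_M :=
  [set theta | Theta theta /\ `|grad (emp_risk z) theta| <= r].

Definition Theta_hat {n : nat} (r : R) (z : 'I_n -> d.-tuple R * R) :
    set 'rV[R]_M :=
  [set theta | feasible r z theta /\
     forall theta', feasible r z theta' -> l1norm theta <= l1norm theta'].

Definition Theta_tilde {n : nat} (r t : R) (z : 'I_n -> d.-tuple R * R) :
    set 'rV[R]_M :=
  threshold t @` Theta_hat r z.

End huber.

(* In C1 -- C4, p stands for P(|W| <= alpha) and q for P(|W| <= 2K + alpha). *)
Section constants.
Context {R : realType}.
Variables (K alpha L beta p q : R) (n M s : nat).

Definition rtilde : R :=
  4 * Num.sqrt 2 * L * (ln M%:R / n%:R)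
  + 2 * Num.sqrt 6 * Num.sqrt (ln M%:R / n%:R).

(* 2K + alpha is the supremum of the absolute derivative of the loss. *)
Definition rpar : R := 6 * (2 * K + alpha) * rtilde.

Definition C1 : R := 8 * (1 + 2 * K) * beta / (p * (beta - 1)) + 6^-1.

Definition eta_par : R := C1 * rpar * s%:R.

Definition C2 : R :=
  2 * Num.sqrt (1 + (1 + L ^+ 2) * (8 * C1 * L ^+ 3 + 4 * L / s%:R))
  + (1 + L ^+ 2) / 3.

Definition C3 : R :=
  (3 * beta)^-1 + 12 * L ^+ 3 * C1 + C2 / (Num.sqrt n%:R * s%:R).

Definition C4 : R := (4 + 2 * C1 * C3) / q.

End constants.

(* Main.v *)
Require Import Defs.
From HB Require Import structures.
From mathcomp Require Import all_boot all_order all_algebra.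
From mathcomp Require Import all_classical all_reals all_analysis.
From mathcomp Require Import measurable_realfun ess_sup_inf ring lra zify.

Set Implicit Arguments.
Unset Strict Implicit.
Unset Printing Implicit Defensive.

Import Order.TTheory GRing.Theory Num.Theory.
Import numFieldNormedType.Exports.

Local Open Scope ring_scope.

(** Write [f_j] for the dictionary, [B = 2K + alpha], [clamp B] for the derivative
of the Huber loss, [l = sqrt (ln M / n)] and [D = theta_hat - theta*].

The vector [theta*] is feasible with high probability, so [D] satisfies the cone
condition and the gradients of the empirical risk at [theta_hat] and [theta*]
differ by at most [2r] in sup norm.  For a parameter [theta] of sup norm at most
[K], the score [clamp B (W_i)] is linear in a perturbation of size [2K] as soon as
[|W_i| <= alpha]; hence [D] nearly minimizes a quadratic form in the weighted Gram
matrix with entries [avg (1_(|W_i| <= alpha) f_j f_k)], and mutual coherence bounds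
the l1 norm of [D].  Inserting this bound into the linearization with weights
[1_(|W_i| <= B)], whose error lives on [| |W_i| - B | <= L |D|_1] (an event of small
probability since the c.d.f. of [W] is Lipschitz), bounds each coordinate of [D] by
[C4 r].

No uniform empirical process bound is needed: only finitely many averages of
bounded variables have to be close to their means, which a Chernoff bound and a
union bound give up to probability [1 / M].  The remaining terms in the
probability bound are nonnegative. *)

(** * The derivative of the Huber loss *)

Section clamp.
Context {R : realFieldType}.
Implicit Types B x y w h a : R.

(** A bound uniform over [Theta] is avoidable because [theta_hat] enters only through [D]. Strong
    monotonicity of the score replaces the score difference by a quadratic form in [D] whose
    coefficients depend on the residuals at the true parameter alone. The linearization error is
    dominated by the indicator of a band whose half-width, [L * l1_radius], is a number fixed before
    sampling. The cost is cruder constants, and [C1] and [C4] have room for them. Condition (e) has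
    two uses: it gives [L * rate <= 1/8], the range in which the Chernoff exponent is admissible,
    and it makes the sampling error small against the compatibility constant. Two obstacles come
    from measure theory. The bounds on the dictionary and on [Theta] hold only almost surely, the
    latter for uncountably many parameters; and the event in the conclusion speaks of all minimizers
    of a random problem. Both are reduced to countably many conditions by separability and
    continuity. *)

Definition clamp B x : R := if x < - B then - B else if B < x then B else x.

Ltac clamp_cases B :=
  repeat (case: (ltP _ (- B)) => ?); repeat (case: (ltP B _) => ?); lra.

Lemma clamp_id B x : `|x| <= B -> clamp B x = x.
Proof.
rewrite ler_norml => /andP[h1 h2]; rewrite /clamp.
by case: ltP => ?; [lra|case: ltP => ?; lra].
Qed.

Lemma clamp_norm B x : 0 <= B -> `|clamp B x| <= B.
Proof.
move=> B0; rewrite ler_norml /clamp.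
by case: ltP => ?; [lra|case: ltP => ?; lra].
Qed.

Lemma clampN B x : 0 <= B -> clamp B (- x) = - clamp B x.
Proof.
move=> B0; rewrite /clamp.
by clamp_cases B.
Qed.

Lemma clamp_monotone B w h : 0 <= B -> 0 <= (clamp B w - clamp B (w - h)) * h.
Proof.
move=> B0; case: (lerP 0 h) => h0.
  by apply: mulr_ge0 => //; rewrite /clamp; clamp_cases B.
apply: mulr_le0; last exact: ltW.
rewrite /clamp; clamp_cases B.
Qed.

Lemma clamp_lipschitz B x y : 0 <= B -> `|clamp B x - clamp B y| <= `|x - y|.
Proof.
move=> B0; rewrite ler_norml.
by case: (ger0P (x - y)) => ?; rewrite /clamp;
  clamp_cases B.
Qed.

(** When [|w| <= a], both [w] and [w - h] lie where [clamp B] is the identity, so the product is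
    exactly [h ^+ 2]; for other [w] monotonicity suffices. It serves with [a = alpha], where [B - a]
    is [2K]. *)
Lemma clamp_strong_monotone B a w h : 0 <= a -> a <= B -> `|h| <= B - a ->
  (`|w| <= a)%R%:R * h ^+ 2 <= (clamp B w - clamp B (w - h)) * h.
Proof.
move=> a0 aB hB; have B0 : 0 <= B by lra.
case: (boolP (`|w| <= a)) => wa; rewrite ?mul0r ?mul1r.
  rewrite !clamp_id ?expr2; first by lra.
    by rewrite (le_trans (ler_normB _ _))//; lra.
  by lra.
exact: clamp_monotone.
Qed.

(** The indicator of [|w| <= B] is the derivative of [clamp B] away from its kinks. If [|w|] is
    farther than [t] from [B], no kink lies between [w] and [w - h] and the linearization is exact;
    inside the band the error is at most [|h|]. *)
Lemma clamp_linearization B w h t : 0 <= B -> `|h| <= t ->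
  `|clamp B w - clamp B (w - h) - (`|w| <= B)%R%:R * h|
    <= `|h| * (`| `|w| - B| <= t)%R%:R.
Proof.
move=> B0 ht; case: (boolP (`| `|w| - B| <= t)) => wt; rewrite ?mulr1 ?mulr0.
  case: (boolP (`|w| <= B)) => wB; rewrite ?mul0r ?mul1r.
    rewrite (clamp_id wB).
    move: wB; rewrite !ler_norml => /andP[? ?]; rewrite /clamp.
    by case: (ger0P h) => ?; clamp_cases B.
  rewrite subr0; apply: (le_trans (clamp_lipschitz _ _ B0)).
  by rewrite opprB addrCA subrr addr0.
move: wt; rewrite -ltNge ltr_normr => /orP[wt|wt].
  have -> : (`|w| <= B) = false by apply/negbTE; rewrite -ltNge; have := normr_ge0 h; lra.
  rewrite mul0r subr0 normr_le0.
  move: ht; rewrite ler_norml => /andP[? ?].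
  move: wt; rewrite ltrBrDl ltr_normr => /orP[?|?]; apply/eqP; rewrite /clamp.
    by clamp_cases B.
  by clamp_cases B.
have wB : `|w| <= B by have := normr_ge0 h; lra.
rewrite wB mul1r !clamp_id//; first by rewrite normr_le0; apply/eqP; ring.
by rewrite (le_trans (ler_normB _ _))//; lra.
Qed.

End clamp.

(** * Sparse recovery from an approximate Gram matrix *)

Section sparse.
Context {R : realFieldType} {M : nat}.
Implicit Types (D : 'I_M -> R) (J : {set 'I_M}) (A : 'I_M -> 'I_M -> R).

Lemma sqr_l1_le D J (s : nat) : (0 < s)%N -> (#|J| <= s)%N ->
  (\sum_(j in J) `|D j|) ^+ 2 / s%:R <= \sum_(j in J) D j ^+ 2.
Proof.
move=> s0 Js; set S1 := \sum_(j in J) `|D j|.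
have s0' : 0 < s%:R :> R by rewrite ltr0n.
(* Cauchy-Schwarz by expanding a square. Centring at [S1 / s] instead of the mean over [J] uses only
   [#|J| <= s] and covers an empty [J]. *)
have : 0 <= \sum_(j in J) (`|D j| - S1 / s%:R) ^+ 2.
  by apply: sumr_ge0 => j _; exact: sqr_ge0.
rewrite (eq_bigr (fun j => D j ^+ 2 - `|D j| * (S1 / s%:R) *+ 2 + (S1 / s%:R) ^+ 2)); last first.
  by move=> j _; rewrite sqrrB real_normK ?num_real.
rewrite big_split sumrB/= sumrMnl -mulr_suml -/S1 sumr_const -[_ *+ #|J|]mulr_natl.
have : #|J|%:R * (S1 / s%:R) ^+ 2 <= s%:R * (S1 / s%:R) ^+ 2.
  by apply: ler_wpM2r; rewrite ?sqr_ge0// ler_nat.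
have -> : s%:R * (S1 / s%:R) ^+ 2 = S1 ^+ 2 / s%:R by field; rewrite gt_eqF.
have -> : S1 * (S1 / s%:R) *+ 2 = 2 * (S1 ^+ 2 / s%:R) by rewrite -mulr_natl; ring.
lra.
Qed.

(* The block of [A] outside [J] need not be close to [p] times the identity: only
   its positivity is used, which is why the constant is 3 and not 4. *)
Lemma restricted_eigenvalue D J A (s : nat) (p eps : R) :
  0 <= p -> 0 <= eps -> (0 < s)%N -> (#|J| <= s)%N ->
  \sum_(j in ~: J) `|D j| <= \sum_(j in J) `|D j| ->
  (forall j k, `|A j k - p *+ (j == k)| <= eps) ->
  0 <= \sum_(j in ~: J) \sum_(k in ~: J) D j * D k * A j k ->
  (p / s%:R - 3 * eps) * (\sum_(j in J) `|D j|) ^+ 2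
    <= \sum_j \sum_k D j * D k * A j k.
Proof.
move=> p0 e0 s0 Js cone HA psd.
have entry j k : p *+ (j == k) * (D j * D k) - eps * `|D j| * `|D k|
    <= D j * D k * A j k.
  have : `|(A j k - p *+ (j == k)) * (D j * D k)| <= eps * (`|D j| * `|D k|).
    by rewrite !normrM ler_wpM2r// mulr_ge0.
  rewrite ler_norml => /andP[+ _]; lra.
set S1 := \sum_(j in J) `|D j| in cone *; set S1c := \sum_(j in ~: J) _ in cone.
have blk (U V : {set 'I_M}) : \sum_(j in U) \sum_(k in V) p *+ (j == k) * (D j * D k)
   - eps * (\sum_(j in U) `|D j|) * (\sum_(k in V) `|D k|)
   <= \sum_(j in U) \sum_(k in V) D j * D k * A j k.
  rewrite [eps * _]mulr_sumr mulr_suml -sumrB; apply: ler_sum => j _.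
  by rewrite mulr_sumr -sumrB; apply: ler_sum => k _.
have splt F : \sum_(j : 'I_M) F j = \sum_(j in J) F j + \sum_(j in ~: J) F j :> R.
  by rewrite (bigID (mem J))/=; congr (_ + _); apply: eq_bigl => j; rewrite inE.
have diag : \sum_(j in J) \sum_(k in J) p *+ (j == k) * (D j * D k)
    = p * \sum_(j in J) D j ^+ 2.
  rewrite mulr_sumr; apply: eq_bigr => j jJ.
  rewrite (bigD1 j)//= eqxx big1 ?addr0 ?expr2// => k /andP[_ /negbTE].
  by rewrite eq_sym => ->; rewrite mulr0n mul0r.
have off (U V : {set 'I_M}) : [disjoint U & V] ->
    \sum_(j in U) \sum_(k in V) p *+ (j == k) * (D j * D k) = 0.
  move=> dUV; apply: big1 => j jU; apply: big1 => k kV.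
  case: eqVneq => [jk|]; last by rewrite mul0r.
  by have := disjointFr dUV jU; rewrite jk kV.
have dJ : [disjoint J & ~: J] by rewrite -finset.setI_eq0 finset.setICr.
have := blk J J; rewrite diag -/S1 => b1.
have := blk J (~: J); rewrite off// -/S1 -/S1c => b2.
have := blk (~: J) J; rewrite off 1?disjoint_sym// -/S1 -/S1c => b3.
have S10 : 0 <= S1 by apply: sumr_ge0.
(* The cone condition bounds the error of each mixed block by [eps * S1 ^+ 2], the error of the
   block [J] times [J]: three in all. *)
have cc : eps * (S1 * S1c) <= eps * (S1 * S1) by rewrite !ler_wpM2l.
have := ler_wpM2l p0 (sqr_l1_le D s0 Js); rewrite -/S1 => b4.
have splt2 (U : {set 'I_M}) : \sum_(j in U) \sum_k D j * D k * A j k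
    = \sum_(j in U) \sum_(k in J) D j * D k * A j k
    + \sum_(j in U) \sum_(k in ~: J) D j * D k * A j k.
  by rewrite -big_split; apply: eq_bigr => j _; rewrite splt.
rewrite splt !splt2.
move: b1 b2 b3 b4 psd cc.
have -> : (p / s%:R - 3 * eps) * S1 ^+ 2 = p * (S1 ^+ 2 / s%:R) - 3 * (eps * (S1 * S1)).
  by ring.
have -> : eps * S1 * S1c = eps * (S1 * S1c) by ring.
have -> : eps * S1c * S1 = eps * (S1 * S1c) by ring.
have -> : eps * S1 * S1 = eps * (S1 * S1) by ring.
lra.
Qed.

(** With [kap] the compatibility constant, [kap * S1 ^+ 2 <= r * |D|_1 <= 2 * r * S1]. Dividing by
    [S1] and using [|D|_1 <= 2 * S1] once more gives the factor 4. *)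
Lemma l1_bound D J A (s : nat) (p eps r : R) :
  0 <= p -> 0 <= eps -> 0 <= r -> (0 < s)%N -> (#|J| <= s)%N ->
  \sum_(j in ~: J) `|D j| <= \sum_(j in J) `|D j| ->
  (forall j k, `|A j k - p *+ (j == k)| <= eps) ->
  0 <= \sum_(j in ~: J) \sum_(k in ~: J) D j * D k * A j k ->
  \sum_j \sum_k D j * D k * A j k <= r * \sum_j `|D j| ->
  0 < p / s%:R - 3 * eps ->
  (\sum_j `|D j|) * (p / s%:R - 3 * eps) <= 4 * r.
Proof.
move=> p0 e0 r0 s0 Js cone HA psd ub kap0.
have lb := restricted_eigenvalue p0 e0 s0 Js cone HA psd.
have {}ub := le_trans lb ub.
have S12 : \sum_j `|D j| <= 2 * \sum_(j in J) `|D j|.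
  rewrite (bigID (mem J))/=.
  have -> : \sum_(i | i \notin J) `|D i| = \sum_(j in ~: J) `|D j|.
    by apply: eq_bigl => j; rewrite inE.
  lra.
set S1 := \sum_(j in J) `|D j| in lb S12 ub cone *.
set kap := _ - _ in kap0 ub *.
have : 0 <= S1 by apply: sumr_ge0.
rewrite le_eqVlt => /predU1P[S0|S0].
  apply: (@le_trans _ _ 0); last by rewrite mulr_ge0.
  by rewrite mulr_le0_ge0 ?(ltW kap0)// (le_trans S12)// -S0 mulr0.
apply: (@le_trans _ _ (2 * S1 * kap)); first by rewrite ler_wpM2r// ltW.
have : kap * S1 ^+ 2 <= 2 * r * S1.
  by apply: (le_trans ub); rewrite [2 * r]mulrC -mulrA ler_wpM2l.
rewrite expr2 mulrA ler_pM2r//; lra.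
Qed.

End sparse.

(** * Deterministic error bounds *)

Section sample.
Context {R : realFieldType} {n M : nat}.
Implicit Types (F : 'I_n -> 'I_M -> R) (w : 'I_n -> R) (D : 'I_M -> R).

Definition avg (g : 'I_n -> R) : R := n%:R^-1 * \sum_(i < n) g i.

Lemma ler_avg (g1 g2 : 'I_n -> R) : (forall i, g1 i <= g2 i) -> avg g1 <= avg g2.
Proof. by move=> g12; rewrite ler_wpM2l ?invr_ge0// ler_sum. Qed.

Lemma avg_ge0 (g : 'I_n -> R) : (forall i, 0 <= g i) -> 0 <= avg g.
Proof. by move=> g0; rewrite mulr_ge0 ?invr_ge0// sumr_ge0. Qed.

Lemma avgB (g1 g2 : 'I_n -> R) : avg g1 - avg g2 = avg (fun i => g1 i - g2 i).
Proof. by rewrite /avg -mulrBr -sumrB. Qed.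

Lemma avgZ c (g : 'I_n -> R) : c * avg g = avg (fun i => c * g i).
Proof. by rewrite /avg mulrCA mulr_sumr. Qed.

Lemma avg_sum (I : Type) (r : seq I) (P : pred I) (g : I -> 'I_n -> R) :
  \sum_(j <- r | P j) avg (g j) = avg (fun i => \sum_(j <- r | P j) g j i).
Proof. by rewrite /avg -mulr_sumr exchange_big. Qed.

Lemma ler_norm_avg (g : 'I_n -> R) : `|avg g| <= avg (fun i => `|g i|).
Proof. by rewrite normrM ger0_norm ?invr_ge0// ler_wpM2l ?invr_ge0// ler_norm_sum. Qed.

Lemma eq_avg (g1 g2 : 'I_n -> R) : g1 =1 g2 -> avg g1 = avg g2.
Proof. by move=> g12; congr (_ * _); apply: eq_bigr. Qed.

Definition wgram F w (a : R) (j k : 'I_M) : R :=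
  avg (fun i => (`|w i| <= a)%R%:R * (F i j * F i k)).

Lemma wgram_quad F w a D (U V : {set 'I_M}) :
  \sum_(j in U) \sum_(k in V) D j * D k * wgram F w a j k
  = avg (fun i => (`|w i| <= a)%R%:R *
      ((\sum_(j in U) D j * F i j) * (\sum_(k in V) D k * F i k))).
Proof.
under eq_bigr => j _ do (under eq_bigr => k _ do rewrite avgZ; rewrite avg_sum).
rewrite avg_sum; apply: eq_avg => i.
rewrite mulr_suml mulr_sumr; apply: eq_bigr => j _.
rewrite mulr_sumr mulr_sumr; apply: eq_bigr => k _; ring.
Qed.

Lemma l1_error F w D (J : {set 'I_M}) (s : nat) (p a B eps r : R) :
  0 <= a -> a <= B ->
  0 <= p -> 0 <= eps -> 0 <= r -> (0 < s)%N -> (#|J| <= s)%N ->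
  \sum_(j in ~: J) `|D j| <= \sum_(j in J) `|D j| ->
  (forall i, `|\sum_j D j * F i j| <= B - a) ->
  (forall j k, `|wgram F w a j k - p *+ (j == k)| <= eps) ->
  (forall j, `|avg (fun i =>
     (clamp B (w i) - clamp B (w i - \sum_j D j * F i j)) * F i j)| <= r) ->
  0 < p / s%:R - 3 * eps ->
  (\sum_j `|D j|) * (p / s%:R - 3 * eps) <= 4 * r.
Proof.
move=> a0 aB p0 e0 r0 s0 Js cone hB Hg Hr kap0.
apply: (@l1_bound R M D J (wgram F w a)) => //.
  (* A block with equal row and column sets is an average of weighted squares, hence nonnegative for
     every sample. *)
  rewrite wgram_quad; apply: avg_ge0 => i.
  by rewrite mulr_ge0// -expr2 sqr_ge0.
have -> : \sum_j \sum_k D j * D k * wgram F w a j k =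
    \sum_(j in [set: 'I_M]) \sum_(k in [set: 'I_M]) D j * D k * wgram F w a j k.
  by apply: eq_big => j; rewrite ?inE// => _; apply: eq_bigl => k; rewrite inE.
rewrite wgram_quad.
(* The middle term pairs [D] with the score difference: strong monotonicity bounds it below by the
   quadratic form, and duality of the l1 and sup norms bounds it above by [r * |D|_1]. *)
apply: (@le_trans _ _ (\sum_j D j * avg (fun i =>
     (clamp B (w i) - clamp B (w i - \sum_j D j * F i j)) * F i j))).
  under [leRHS]eq_bigr do rewrite avgZ.
  rewrite avg_sum; apply: ler_avg => i.
  have -> : \sum_(j in [set: 'I_M]) D j * F i j = \sum_j D j * F i j.
    by apply: eq_bigl => j; rewrite inE.
  rewrite -expr2; apply: (le_trans (clamp_strong_monotone _ a0 aB (hB i))).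
  by rewrite mulr_sumr le_eqVlt; apply/orP; left; apply/eqP/eq_bigr => j _; ring.
rewrite mulr_sumr; apply: ler_sum => j _.
apply: (le_trans (ler_norm _)); rewrite normrM mulrC.
by rewrite ler_wpM2r.
Qed.

(** Coordinate [j] of the score difference is [q * D j] up to two errors: the linearization, which
    costs [L ^+ 2 * kap * |D|_1], and the distance of the Gram row from [q] times a unit vector,
    which costs [eps * |D|_1]. The half-width [t] may exceed [L * |D|_1], so that it can be chosen
    independently of the sample. *)
Lemma sup_error F w D (q B L t kap eps r : R) :
  0 <= B -> 0 <= L -> 0 <= q ->
  L * \sum_j `|D j| <= t ->
  (forall i j, `|F i j| <= L) ->
  (forall j k, `|wgram F w B j k - q *+ (j == k)| <= eps) ->
  avg (fun i => (`| `|w i| - B| <= t)%R%:R) <= kap ->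
  (forall j, `|avg (fun i =>
     (clamp B (w i) - clamp B (w i - \sum_j D j * F i j)) * F i j)| <= r) ->
  forall j, q * `|D j| <= r + (\sum_j `|D j|) * (eps + L ^+ 2 * kap).
Proof.
move=> B0 L0 q0 Lt FL Hg Hk Hr j.
set h := fun i => \sum_j D j * F i j.
have hL i : `|h i| <= L * \sum_j `|D j|.
  apply: (le_trans (ler_norm_sum _ _ _)); rewrite mulr_sumr; apply: ler_sum => k _.
  by rewrite normrM mulrC ler_wpM2r.
set T := fun i => (clamp B (w i) - clamp B (w i - h i)) * F i j.
have lin : `|avg T - \sum_k D k * wgram F w B k j| <= (\sum_j `|D j|) * (L ^+ 2 * kap).
  have -> : \sum_k D k * wgram F w B k j = avg (fun i => (`|w i| <= B)%R%:R * h i * F i j).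
    under eq_bigr do rewrite avgZ.
    rewrite avg_sum; apply: eq_avg => i.
    rewrite mulr_sumr mulr_suml; apply: eq_bigr => k _; ring.
  rewrite avgB; apply: (le_trans (ler_norm_avg _)).
  apply: (@le_trans _ _ ((L ^+ 2 * \sum_j `|D j|) *
     avg (fun i => (`| `|w i| - B| <= t)%R%:R))).
    rewrite avgZ; apply: ler_avg => i.
    rewrite /T -mulrBl normrM.
    have hu := clamp_linearization (w i) B0 (le_trans (hL i) Lt).
    apply: (@le_trans _ _ (`|h i| * (`| `|w i| - B| <= t)%R%:R * L)).
      exact: ler_pM.
    rewrite mulrAC ler_wpM2r//.
    rewrite expr2 -mulrA [leRHS]mulrC ler_wpM2r//.
  rewrite [in leRHS]mulrCA mulrA ler_wpM2l// mulr_ge0 ?sqr_ge0//.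
  exact: sumr_ge0.
have row : `|\sum_k D k * wgram F w B k j - q * D j| <= (\sum_j `|D j|) * eps.
  have -> : q * D j = \sum_k D k * (q *+ (k == j)).
    rewrite (bigD1 j)//= eqxx mulr1n big1 => [|k /negbTE ->].
      by rewrite addr0 mulrC.
    by rewrite mulr0n mulr0.
  rewrite -sumrB; apply: (le_trans (ler_norm_sum _ _ _)).
  rewrite mulr_suml; apply: ler_sum => k _.
  by rewrite -mulrBr normrM ler_wpM2l.
have -> : q * `|D j| = `|q * D j| by rewrite normrM ger0_norm.
set X := \sum_k _ in lin row.
have -> : q * D j = avg T - (avg T - X) - (X - q * D j) by ring.
have := Hr j; rewrite -/T => hT.
rewrite mulrDr [_ + (_ + _)]addrCA [leRHS]addrC.
apply: (le_trans (ler_normB _ _)).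
apply: lerD => //; apply: (le_trans (ler_normB _ _)); exact: lerD.
Qed.

End sample.

(** * Numerical constants *)

Section constants.
Context {R : realType}.
Variables (K alpha L beta p q : R) (n M s : nat).
Hypotheses (n0 : (0 < n)%N) (M2 : (2 <= M)%N) (s1 : (1 <= s)%N).
Hypotheses (K0 : 0 < K) (a0 : 0 < alpha) (L1 : 1 <= L) (b1 : 1 < beta).
Hypotheses (p0 : 0 < p) (p1 : p <= 1) (q0 : 0 < q) (q1 : q <= 1).
Hypothesis qB : q <= 2 * (2 * K + alpha).

(* [lra] ignores section hypotheses that have not been copied to the context. *)
Ltac lr0 := pose proof K0; pose proof a0; pose proof L1; lra.
Ltac lr := pose proof K0; pose proof a0; pose proof L1; pose proof b1;
  pose proof p0; pose proof p1; pose proof q0; pose proof q1; pose proof qB; lra.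

Definition rate : R := Num.sqrt (ln M%:R / n%:R).

Let rt : R := rtilde L n M.
Let r : R := rpar K alpha L n M.
Let c1 : R := C1 K beta p.
(** [a * s] is the inverse of the compatibility constant [p / s - 3 * (p * coherence)], and the
    first summand of [C1] is [8 * (1 + 2 * K) * a]. *)
Let a : R := beta / (p * (beta - 1)).

Hypothesis sr : s%:R <= (Num.sqrt r)^-1.
Hypothesis small : 12 * L ^+ 3 * eta_par K alpha L beta p n M s + L * rt
    + C2 K L beta p s / (Num.sqrt n%:R * s%:R ^+ 2) <= q / 2.

Lemma rate_gt0 : 0 < rate.
Proof. by rewrite sqrtr_gt0 divr_gt0 ?ln_gt0 ?ltr0n// ltr1n. Qed.

Lemma rtilde_ge : 4 * rate <= rt.
Proof.
have h : 2 <= Num.sqrt 6 :> R.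
  by rewrite -(@ler_pXn2r _ 2)// ?nnegrE ?sqrtr_ge0// sqr_sqrtr//; lr0.
have l0 := rate_gt0.
have h2 : 0 <= 4 * Num.sqrt 2 * L * (ln M%:R / n%:R).
  by rewrite !mulr_ge0 ?sqrtr_ge0 ?invr_ge0 ?ln_ge0 ?ler1n//; [lr0|exact: ltnW].
rewrite /rt /rtilde -/rate; nra.
Qed.

Let B0 : 0 < 2 * K + alpha.
Proof. by lr0. Qed.

Lemma rpar_gt0 : 0 < r.
Proof.
rewrite /r /rpar -/rt !mulr_gt0//; have := rtilde_ge; have := rate_gt0; lr0.
Qed.

(** [6 * B * rate] is the deviation allowed for the score at the true parameter, so this inequality
    makes that parameter feasible. *)
Lemma rate_le_rpar : 6 * (2 * K + alpha) * rate <= r.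
Proof.
have := rtilde_ge; have := rate_gt0; rewrite /r /rpar -/rt => *.
by rewrite ler_wpM2l//; [have := B0; lr0|lr0].
Qed.

Let a1 : 1 <= a.
Proof.
have pb : 0 < p * (beta - 1) by rewrite mulr_gt0//; lr.
rewrite /a ler_pdivlMr// mul1r.
have : p * (beta - 1) <= 1 * (beta - 1) by rewrite ler_wpM2r//; lr.
lr.
Qed.

Let c1a : 8 * a <= c1.
Proof.
rewrite /c1 /C1 -[_ * beta / _]mulrA -/a.
have : 8 * a <= 8 * (1 + 2 * K) * a by rewrite ler_wpM2r//; have := a1; lr.
lr.
Qed.

Let s1' : 1 <= s%:R :> R. Proof. by rewrite ler1n. Qed.

Let C2_ge0 : 0 <= C2 K L beta p s.
Proof.
rewrite /C2 addr_ge0// ?mulr_ge0 ?sqrtr_ge0//.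
have := sqr_ge0 L; lr.
Qed.

Let L3 : 1 <= L ^+ 3. Proof. by rewrite exprn_ege1. Qed.

(* Since [q <= 2 (2K + alpha)], hypothesis [small] is homogeneous in [2K + alpha],
   which cancels. *)
Let prod_small : 72 * (L ^+ 3 * c1 * rt * s%:R) <= 1.
Proof.
have h1 : 0 <= C2 K L beta p s / (Num.sqrt n%:R * s%:R ^+ 2).
  by rewrite divr_ge0// mulr_ge0 ?sqrtr_ge0 ?exprn_ge0.
have h2 : 0 <= L * rt.
  by rewrite mulr_ge0; have := rtilde_ge; have := rate_gt0; move=> *; lr.
rewrite -(ler_pM2r B0) mul1r.
have -> : 72 * (L ^+ 3 * c1 * rt * s%:R) * (2 * K + alpha)
    = 12 * L ^+ 3 * eta_par K alpha L beta p n M s.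
  by rewrite /eta_par /rpar -/c1 -/rt; ring.
have := small; lr.
Qed.

(** The summand [L * rt] of [small] gives [4 * L * rate <= L * rt <= q / 2 <= 1 / 2]. *)
Lemma rate_small : L * rate <= 8^-1.
Proof.
have h1 : 0 <= C2 K L beta p s / (Num.sqrt n%:R * s%:R ^+ 2).
  by rewrite divr_ge0// mulr_ge0 ?sqrtr_ge0 ?exprn_ge0.
have h2 : 0 <= 12 * L ^+ 3 * eta_par K alpha L beta p n M s.
  rewrite /eta_par -/c1 !mulr_ge0 ?exprn_ge0//; have := rtilde_ge; have := rate_gt0;
    have := B0; have := c1a; have := a1; rewrite -?/rt; lr.
have : L * (4 * rate) <= L * rt by rewrite ler_wpM2l ?rtilde_ge//; lr.
have := small; lr.
Qed.

(** [2304 = 72 * 8 * 4]: insert [8 * a <= c1] and [4 * rate <= rt] into [prod_small]. *)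
Let rate_prod : 2304 * (L ^+ 3 * a * rate * s%:R) <= 1.
Proof.
apply: le_trans prod_small.
have -> : 2304 * (L ^+ 3 * a * rate * s%:R)
  = 72 * (L ^+ 3 * (8 * a) * (4 * rate) * s%:R) by ring.
have L30 : 0 <= L ^+ 3 := le_trans ler01 L3.
have := rate_gt0 => l0; have := a1 => a1'.
rewrite ler_wpM2l// ler_wpM2r//; apply: ler_pM; rewrite ?rtilde_ge//.
- by rewrite mulr_ge0//; lr.
- by lr.
- by rewrite ler_wpM2l// c1a.
Qed.

Definition coherence : R := (3 * beta * s%:R)^-1.
(* Twice the quantity [eta] of the paper: [C4] leaves room for the factor 2. *)
Definition l1_radius : R := 2 * c1 * r * s%:R.

Let compat : p / s%:R - 3 * (p * coherence) = (a * s%:R)^-1.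
Proof.
rewrite /coherence /a; field.
by rewrite !gt_eqF ?subr_gt0//; have := s1'; lr.
Qed.

(** Multiplied by [a * s], the constant becomes [1 - 18 * v] with [v = L * a * rate * s], and
    [v <= 1 / 2304] by [rate_prod]. *)
Lemma compatibility_gt0 :
  0 < p / s%:R - 3 * (p * coherence + 6 * L * rate).
Proof.
rewrite [3 * (_ + _)]mulrDr opprD addrA compat.
have as0 : 0 < a * s%:R by rewrite mulr_gt0//; have := a1; have := s1'; lr.
rewrite -(ltr_pM2r as0) mul0r mulrBl mulVf ?gt_eqF//.
have : L * a * rate * s%:R <= L ^+ 3 * a * rate * s%:R.
  rewrite !ler_wpM2r//; [exact: (ltW rate_gt0)|by have := a1; lr|].
  by rewrite -[leLHS]expr1 ler_weXn2l.
have := rate_prod.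
have -> : 3 * (6 * L * rate) * (a * s%:R) = 18 * (L * a * rate * s%:R) by ring.
lr.
Qed.

(** After multiplication by [a * s] the hypothesis reads [x * (1 - 18 * v) <= 8 * r * a * s], whose
    right side is at most [c1 * r * s]. Since [1 - 18 * v >= 1 / 2], this costs the factor 2 in
    [l1_radius]. *)
Lemma l1_radius_ge x :
  x * (p / s%:R - 3 * (p * coherence + 6 * L * rate)) <= 4 * (2 * r) ->
  x <= l1_radius.
Proof.
rewrite [3 * (_ + _)]mulrDr opprD addrA compat => h.
have as0 : 0 < a * s%:R by rewrite mulr_gt0//; have := a1; have := s1'; lr.
have : L * a * rate * s%:R <= L ^+ 3 * a * rate * s%:R.
  rewrite !ler_wpM2r//; [exact: (ltW rate_gt0)|by have := a1; lr|].
  by rewrite -[leLHS]expr1 ler_weXn2l.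
have := rate_prod; set u := L ^+ 3 * _ * _ * _; set v := L * a * _ * _ => h1 h2.
have := rpar_gt0 => r0.
have h3 : x * (1 - 18 * v) <= 8 * r * a * s%:R.
  move: h; rewrite -(ler_pM2r as0).
  have -> : x * ((a * s%:R)^-1 - 3 * (6 * L * rate)) * (a * s%:R)
     = x * (1 - 18 * v).
    rewrite /v; field; rewrite !gt_eqF//; have := s1'; have := a1; lr.
  lr.
have h4 : 8 * r * a * s%:R <= c1 * r * s%:R.
  have -> : 8 * r * a * s%:R = 8 * a * r * s%:R by ring.
  by rewrite !ler_wpM2r// ?ltW.
have c10 : 0 <= c1 by have := c1a; have := a1; lr.
have R0 : 0 <= c1 * r * s%:R.
  by apply: mulr_ge0 => //; apply: mulr_ge0 => //; exact: ltW.
rewrite /l1_radius -[2 * c1 * r]mulrA -[2 * _ * _]mulrA.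
case: (lerP x 0) => x0; first by lr.
have h5 : x * (1 / 2) <= x * (1 - 18 * v) by rewrite ler_pM2l//; lr.
lr.
Qed.

(** The right side is [4 r + 2 c1 r / (3 beta) + 24 L^3 c1 (c1 r) + 2 c1 r w]. The coherence term
    fits the second summand because [q <= 1]. Hypothesis [sr] gives [r s^2 <= 1], so the band term,
    quadratic in the radius, takes 16 of the 24. The sampling errors are at most [24 / 2304] times
    [c1 r] and fit in the remaining 8. *)
Lemma sup_radius :
  2 * r + l1_radius * (q * coherence + 6 * L * rate
     + L ^+ 2 * (4 * (L * l1_radius) + 6 * rate))
  <= q * (C4 K L beta p q n s * r).
Proof.
have := rpar_gt0 => r0; have c11 := c1a; have a11 := a1; have s11 := s1'.
have l0 := rate_gt0.
have -> : q * (C4 K L beta p q n s * r) = (4 + 2 * c1 * C3 K L beta p n s) * r.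
  by rewrite /C4 -/c1; field; rewrite gt_eqF.
have h1 : 0 <= C2 K L beta p s / (Num.sqrt n%:R * s%:R).
  by rewrite divr_ge0// mulr_ge0 ?sqrtr_ge0.
have h2 : r * s%:R ^+ 2 <= 1.
  have sr0 : 0 < Num.sqrt r by rewrite sqrtr_gt0.
  rewrite -[X in X * _](sqr_sqrtr (ltW r0)) -exprMn expr_le1// ?mulr_ge0//.
  by rewrite mulrC -ler_pdivlMr// div1r.
have v1 : 2304 * (L * rate * s%:R) <= 1.
  apply: le_trans rate_prod.
  have : L <= L ^+ 3 * a.
    by rewrite -[leLHS]mulr1; apply: ler_pM; rewrite ?(le_trans _ L1)// -[leLHS]expr1 ler_weXn2l.
  move=> h; apply: ler_wpM2l; first exact: ler0n.
  apply: ler_wpM2r; first by [].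
  by apply: ler_wpM2r; first exact: (ltW l0).
have v2 : 2304 * (L ^+ 2 * rate * s%:R) <= 1.
  apply: le_trans rate_prod.
  have : L ^+ 2 <= L ^+ 3 * a.
    by rewrite -[leLHS]mulr1; apply: ler_pM; rewrite ?sqr_ge0// ler_weXn2l.
  move=> h; apply: ler_wpM2l; first exact: ler0n.
  apply: ler_wpM2r; first by [].
  by apply: ler_wpM2r; first exact: (ltW l0).
set u1 := L * rate * s%:R in v1; set u2 := L ^+ 2 * rate * s%:R in v2.
have cr : 0 < c1 * r by rewrite mulr_gt0//; lr.
have -> : l1_radius * (q * coherence + 6 * L * rate
     + L ^+ 2 * (4 * (L * l1_radius) + 6 * rate))
   = 2 * (c1 * r) * (q * (3 * beta)^-1) + 12 * (c1 * r) * u1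
     + 16 * (L ^+ 3 * c1) * (c1 * r) * (r * s%:R ^+ 2) + 12 * (c1 * r) * u2.
  rewrite /l1_radius /coherence /u1 /u2; field.
  by rewrite !gt_eqF//; lr.
rewrite /C3 -/c1; set w := C2 _ _ _ _ _ / _ in h1 *.
have -> : (4 + 2 * c1 * ((3 * beta)^-1 + 12 * L ^+ 3 * c1 + w)) * r
  = 4 * r + 2 * (c1 * r) * (3 * beta)^-1 + 24 * (L ^+ 3 * c1) * (c1 * r) + 2 * (c1 * r) * w
  by ring.
have b0 : 0 < (3 * beta)^-1 by rewrite invr_gt0; lr.
have t1 : 2 * (c1 * r) * (q * (3 * beta)^-1) <= 2 * (c1 * r) * (3 * beta)^-1.
  by rewrite ler_pM2l ?ler_piMl ?(ltW b0)//; lr.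
have t2 : (c1 * r) * u1 <= (c1 * r) * 2304^-1 by rewrite ler_pM2l//; lr.
have t3 : (c1 * r) * u2 <= (c1 * r) * 2304^-1 by rewrite ler_pM2l//; lr.
have Lc : 1 <= L ^+ 3 * c1 by rewrite -[leLHS]mulr1; apply: ler_pM => //; lr.
have t4 : (L ^+ 3 * c1) * (c1 * r) * (r * s%:R ^+ 2) <= (L ^+ 3 * c1) * (c1 * r).
  by rewrite ler_piMr// mulr_ge0//; lr.
have t5 : 1 * (c1 * r) <= (L ^+ 3 * c1) * (c1 * r) by rewrite ler_pM2r.
have t6 : 0 <= c1 * r * w by rewrite mulr_ge0// ltW.
lr.
Qed.

End constants.

Local Open Scope classical_set_scope.
Local Open Scope ring_scope.

(** * Gradient of the empirical risk *)

(** A quadratic remainder already determines the directional derivative, so the loss is not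
    differentiated piece by piece at the points where its formulas meet. *)
Lemma derive_of_quadratic_bound (R : realType) (V : normedModType R) (F : V -> R)
    (x v : V) (g c : R) :
  (forall h : R, `|F (h *: v + x) - F x - h * g| <= c * h ^+ 2) -> 'D_v F x = g.
Proof.
move=> HF; rewrite /derive; apply: cvg_lim => //.
apply/cvgrPdist_lt => e e0.
have c1 : 0 < `|c| + 1 by rewrite ltr_pwDr.
have d0 : 0 < e / (`|c| + 1) by rewrite divr_gt0.
near=> h.
have h0 : h != 0 by near: h; exact: nbhs_dnbhs_neq.
rewrite -[g](mulKf h0) -mulrBr normrM distrC normfV.
rewrite ltr_pdivrMl ?normr_gt0//.
apply: (@le_lt_trans _ _ (c * h ^+ 2)); first by rewrite /= (le_trans _ (HF h))//.
rewrite -(real_normK (num_real h)) expr2 mulrCA ltr_pM2l ?normr_gt0//.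
apply: (@le_lt_trans _ _ ((`|c| + 1) * `|h|)).
  by rewrite ler_wpM2r// (le_trans (ler_norm c))// lerDl.
rewrite -ltr_pdivlMl// mulrC.
near: h; apply: dnbhs0_lt; exact: d0.
Unshelve. all: by end_near. Qed.

Section gradient.
Context {R : realType}.
Variables (K alpha : R).
Hypotheses (K0 : 0 < K) (alpha0 : 0 < alpha).
Local Notation B := (2 * K + alpha).

Lemma huber_taylor (x y : R) :
  `|huber K alpha y - huber K alpha x - (y - x) * clamp B x| <= (y - x) ^+ 2.
Proof.
have B0 : 0 < B by pose proof K0; pose proof alpha0; lra.
rewrite /huber /clamp; move: B B0 => b b0.
(* Removing the absolute values makes each of the nine cases for [x] and [y] polynomial. *)
have E (z : R) : (if `|z| <= b then z ^+ 2 / 2 else b * `|z| - b ^+ 2 / 2)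
   = if z < - b then b * (- z) - b ^+ 2 / 2 else if b < z then b * z - b ^+ 2 / 2
     else z ^+ 2 / 2.
  case: (ltP z (- b)) => h1.
    have -> : `|z| = - z by rewrite ltr0_norm//; lra.
    by case: leP => //; lra.
  case: (ltP b z) => h2.
    have -> : `|z| = z by rewrite gtr0_norm//; lra.
    by case: leP => //; lra.
  by rewrite ifT// ler_norml h1 h2.
rewrite !E ler_norml.
case: (ltP x (- b)) => hx1; [|case: (ltP b x) => hx2];
(case: (ltP y (- b)) => hy1; [|case: (ltP b y) => hy2]); apply/andP; split;
  have := sqr_ge0 (y - b); have := sqr_ge0 (y + b); have := sqr_ge0 (x - b);
  have := sqr_ge0 (x + b); have := sqr_ge0 (y - x); rewrite ?expr2 => *; nra.
Qed.

Context {d M : nat}.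
Variable f : 'I_M -> {mfun d.-tuple R >-> R}.

Definition score (theta : 'rV[R]_M) (j : 'I_M) (z : d.-tuple R * R) : R :=
  clamp B (z.2 - lincomb f theta z.1) * f j z.1.

Lemma lincombD theta theta' x :
  lincomb f (theta + theta') x = lincomb f theta x + lincomb f theta' x.
Proof. by rewrite /lincomb -big_split; apply: eq_bigr => j _; rewrite mxE mulrDl. Qed.

Lemma lincombN theta x : lincomb f (- theta) x = - lincomb f theta x.
Proof. by rewrite /lincomb -sumrN; apply: eq_bigr => j _; rewrite mxE mulNr. Qed.

Lemma lincombB theta theta' x :
  lincomb f (theta - theta') x = lincomb f theta x - lincomb f theta' x.
Proof. by rewrite lincombD lincombN. Qed.

Lemma lincomb_delta h j x : lincomb f (h *: delta_mx 0 j) x = h * f j x.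
Proof.
rewrite /lincomb (bigD1 j)//= big1 ?addr0 => [|k kj].
  by rewrite !mxE !eqxx mulr1.
by rewrite !mxE (negbTE kj) andbF mulr0 mul0r.
Qed.

Lemma grad_emp_risk (n : nat) (z : 'I_n -> d.-tuple R * R) theta j :
  grad (emp_risk K alpha f z) theta 0 j = - avg (fun i => score theta j (z i)).
Proof.
rewrite mxE.
apply: (@derive_of_quadratic_bound _ _ _ _ _ _ (avg (fun i => f j (z i).1 ^+ 2))) => h.
have -> : h * - avg (fun i => score theta j (z i))
  = avg (fun i => - h * score theta j (z i)) by rewrite mulrN -mulNr avgZ.
rewrite /emp_risk avgB avgB mulrC avgZ.
apply: (le_trans (ler_norm_avg _)); apply: ler_avg => i.
rewrite /Qloss /score lincombD lincomb_delta.
set u := (z i).2; set v := lincomb f theta _; set c := f j _.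
have := huber_taylor (u - v) (u - (h * c + v)).
have -> : u - (h * c + v) - (u - v) = - (h * c) by ring.
by rewrite sqrrN exprMn; congr (`|_ - _| <= _); ring.
Qed.

End gradient.

(** * Independence and concentration *)

Section factor.
Context {d1 d2 : measure_display} {T : measurableType d1} {T' : measurableType d2}
  {R : realType}.
Variables (mu : {measure set T -> \bar R}) (nu : {measure set T' -> \bar R}).
Variables (V : T -> T') (H : T -> R) (c : R).
Hypotheses (mV : measurable_fun setT V) (mH : measurable_fun setT H).
Hypotheses (H0 : forall x, 0 <= H x) (c0 : 0 <= c).
Hypothesis HV : forall A, measurable A ->
  (\int[mu]_x (H x * \1_A (V x))%:E = c%:E * nu A)%E.

Import HBNNSimple.

Let factor_nnsfun (g : {nnsfun T' >-> R}) :
  (\int[mu]_x (H x * g (V x))%:E = \int[nu]_y (c * g y)%:E)%E.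
Proof.
have mg r : measurable (g @^-1` [set r]) by [].
have mind r : measurable_fun setT (fun x => \1_(g @^-1` [set r]) (V x) : R).
  exact: (measurableT_comp (measurable_indic (mg r)) mV).
have gE y : g y = \sum_(r \in range g) r * \1_(g @^-1` [set r]) y by rewrite fimfunE.
have r0 r y : 0 <= r * \1_(g @^-1` [set r]) y.
  by have := nnfun_muleindic_ge0 g r y; rewrite lee_fin.
have rEl x : (H x * g (V x))%:E =
    (\sum_(r \in range g) (H x * (r * \1_(g @^-1` [set r]) (V x)))%:E)%E.
  rewrite gE !fsbig_finite//= mulr_sumr sumEFin//.
have rEr y : (c * g y)%:E =
    (\sum_(r \in range g) (c * (r * \1_(g @^-1` [set r]) y))%:E)%E.
  rewrite gE !fsbig_finite//= mulr_sumr sumEFin//.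
under eq_integral do rewrite rEl.
under [RHS]eq_integral do rewrite rEr.
rewrite ge0_integral_fsum//; last 2 first.
  by move=> r; apply/measurable_EFinP; do 2 apply: measurable_funM => //.
  by move=> r x _; rewrite lee_fin mulr_ge0.
rewrite ge0_integral_fsum//; last 2 first.
  by move=> r; apply/measurable_EFinP; do 2 apply: measurable_funM => //.
  by move=> r x _; rewrite lee_fin mulr_ge0.
apply: eq_fsbigr => r; rewrite inE => -[y _ <-{r}].
under eq_integral do rewrite mulrCA EFinM.
rewrite ge0_integralZl//; last 3 first.
  by apply/measurable_EFinP; exact: measurable_funM.
  by move=> x _; rewrite lee_fin mulr_ge0.
  by rewrite lee_fin.
rewrite HV//.
under [RHS]eq_integral do rewrite EFinM EFinM.
rewrite ge0_integralZl//; last 2 first.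
  apply: emeasurable_funM => //; apply/measurable_EFinP => //.
  by move=> x _; rewrite mule_ge0// lee_fin.
rewrite ge0_integralZl ?lee_fin//; last exact/measurable_EFinP.
by rewrite integral_indic// setIT muleCA.
Qed.

(** A product rule known for indicators of [V] passes to simple functions, then to [g] by monotone
    convergence. The weight [H] is arbitrary, so the rule can be iterated with [H] containing the
    factors already treated. *)
Lemma ge0_integral_factor (g : T' -> R) :
  measurable_fun setT g -> (forall y, 0 <= g y) ->
  (\int[mu]_x (H x * g (V x))%:E = c%:E * \int[nu]_y (g y)%:E)%E.
Proof.
move=> mg g0.
have meg : measurable_fun setT (EFin \o g) by exact/measurable_EFinP.
pose f_ := nnsfun_approx measurableT meg.
have cvgf y : (f_ n y)%:E @[n --> \oo] --> (g y)%:E.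
  by apply: (cvg_nnsfun_approx measurableT meg) => // t _; rewrite lee_fin.
have ndf y : {homo (fun n => f_ n y) : m n / (m <= n)%N >-> m <= n}.
  by move=> m n mn; exact/lefP/nd_nnsfun_approx.
have cvgM (k : R) y : (k * f_ n y)%:E @[n --> \oo] --> (k * g y)%:E.
  have := cvgf y; move/fine_cvgP => [_ /= h].
  by apply: cvg_EFin; [exact: nearW|exact: cvgMl_tmp].
rewrite -ge0_integralZl//; last by move=> y _; rewrite lee_fin.
transitivity (limn (fun n => \int[mu]_x (H x * f_ n (V x))%:E)%E).
  rewrite -monotone_convergence//.
  - by apply: eq_integral => x _; apply/esym/cvg_lim => //; exact: cvgM.
  - move=> n; apply/measurable_EFinP/measurable_funM => //.
    exact: measurableT_comp.
  - by move=> n x _; rewrite lee_fin mulr_ge0.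
  - by move=> x _ m n mn; rewrite lee_fin ler_wpM2l// ndf.
under eq_fun do rewrite factor_nnsfun.
rewrite -monotone_convergence//.
- by apply: eq_integral => x _; apply/cvg_lim => //; exact: cvgM.
- by move=> n; apply/measurable_EFinP/measurable_funM.
- by move=> n x _; rewrite lee_fin mulr_ge0.
- by move=> x _ m n mn; rewrite lee_fin ler_wpM2l// ndf.
Qed.

End factor.

Section independence.
Context {dO d1 : measure_display} {Omega : measurableType dO} {T : measurableType d1}
  {R : realType} {P : probability Omega R}.

(* Mutual independence is the product rule for indicators; these are replaced by
   [g] one coordinate at a time. *)
Lemma expectation_prod_iid (n : nat) (Z : 'I_n -> {RV P >-> T}) (g : T -> R) (m : R) :
  mutually_independent P (fun i => Z i : Omega -> T) ->
  measurable_fun setT g -> (forall z, 0 <= g z) -> 0 <= m ->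
  (forall i, \int[P]_w (g (Z i w))%:E = m%:E)%E ->
  (\int[P]_w (\prod_(i < n) g (Z i w))%:E = (m ^+ n)%:E)%E.
Proof.
move=> indep mg g0 m0 Eg.
pose h k (A : 'I_n -> set T) (i : 'I_n) : T -> R := if (i < k)%N then g else \1_(A i).
pose e k (A : 'I_n -> set T) (i : 'I_n) : R :=
  if (i < k)%N then m else fine (P (Z i @^-1` A i)).
have mh k A i : measurable (A i) -> measurable_fun setT (h k A i).
  by move=> mA; rewrite /h; case: ifP => // _; exact: measurable_indic.
have h0 k A i z : 0 <= h k A i z by rewrite /h; case: ifP.
have e0 k A i : 0 <= e k A i by rewrite /e; case: ifP => // _; rewrite fine_ge0.
have pre i A : measurable A -> measurable (Z i @^-1` A).
  by move=> mA; rewrite -[X in measurable X]setTI; exact: measurable_funPT.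
(* The claim holds for all [A] at once: the induction step puts an arbitrary [A'] in slot [k], which
   yields the product rule required by [ge0_integral_factor] for that coordinate. *)
suff claim k : (k <= n)%N -> forall A, (forall i, measurable (A i)) ->
    (\int[P]_w (\prod_(i < n) h k A i (Z i w))%:E = (\prod_(i < n) e k A i)%:E)%E.
  have := claim n (leqnn n) (fun=> setT) (fun=> measurableT).
  rewrite (eq_bigr (fun=> m)) => [|i _]; last by rewrite /e ltn_ord.
  rewrite prodr_const card_ord => <-; apply: eq_integral => w _.
  by congr (_%:E); apply: eq_bigr => i _; rewrite /h ltn_ord.
elim: k => [_ A mA|k IH kn A mA].
  pose J := [set: 'I_n]%SET.
  have -> : (fun w => (\prod_(i < n) h 0 A i (Z i w))%:E) =
      EFin \o \1_(\bigcap_(i in [set` J]) (Z i @^-1` A i)).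
    apply/funext => w /=; congr (_%:E).
    rewrite indicE; case: (boolP (w \in _)) => [/set_mem wA|/negP wA] /=.
      apply: big1 => i _; rewrite /h ltn0 indicE mem_set//.
      by apply: (wA i); rewrite /= inE.
    have [i iA] : exists i, ~ A i (Z i w).
      apply/existsNP => hA; apply: wA; apply/mem_set => i _; exact: hA.
    rewrite (bigD1 i)//= /h ltn0 indicE memNset ?mul0r//.
  rewrite integral_indic//; last first.
    by apply: fin_bigcap_measurable => // i _; exact: pre.
  have {}indep := indep J A mA; rewrite setIT [LHS]indep -prodEFin.
  apply: eq_big => [i|i _]; first by rewrite inE.
  by rewrite /e ltn0 fineK// fin_num_measure//; exact: pre.
have IHk := IH (ltnW kn).
pose i0 := Ordinal kn.
have hS i : i != i0 -> h k.+1 A i = h k A i.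
  move=> ii0; rewrite /h ltnS leq_eqVlt.
  by have -> : (i == k :> nat) = false by apply/negbTE; exact: ii0.
have eS i : i != i0 -> e k.+1 A i = e k A i.
  move=> ii0; rewrite /e ltnS leq_eqVlt.
  by have -> : (i == k :> nat) = false by apply/negbTE; exact: ii0.
pose H w := \prod_(i < n | i != i0) h k A i (Z i w).
pose c := \prod_(i < n | i != i0) e k A i.
have := @ge0_integral_factor _ _ _ _ _ P (distribution P (Z i0)) (Z i0) H c.
move=> /(_ _ _ _ _ _ g mg g0) fac.
transitivity (\int[P]_w (H w * g (Z i0 w))%:E)%E.
  apply: eq_integral => w _; congr (_%:E).
  rewrite (bigD1 i0)//= mulrC; congr (_ * _); last by rewrite /h ltnSn.
  by apply: eq_bigr => i ii0; rewrite hS.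
rewrite fac//.
- rewrite (@ge0_integral_distribution _ _ _ _ _ _ _ (EFin \o g))//=; last exact/measurable_EFinP.
  rewrite Eg (bigD1 i0)//= [in RHS]mulrC EFinM; congr (_%:E * _)%E.
    by apply: eq_bigr => i ii0; rewrite eS.
  by rewrite /e ltnSn.
- rewrite /H; under eq_fun do rewrite -big_filter.
  apply: measurable_prod => i _; apply: measurableT_comp => //; exact: mh.
- by move=> w; apply: prodr_ge0.
- by apply: prodr_ge0.
- move=> A' mA'.
  pose A'' i := if i == i0 then A' else A i.
  have mA'' i : measurable (A'' i) by rewrite /A''; case: ifP.
  have hA i : i != i0 -> h k A'' i = h k A i.
    by move=> /negbTE ii0; rewrite /h /A'' ii0.
  have eA i : i != i0 -> e k A'' i = e k A i.
    by move=> /negbTE ii0; rewrite /e /A'' ii0.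
  transitivity (\int[P]_w (\prod_(i < n) h k A'' i (Z i w))%:E)%E.
    apply: eq_integral => w _; congr (_%:E).
    rewrite [RHS](bigD1 i0)//= [RHS]mulrC; congr (_ * _).
      by apply: eq_bigr => i ii0; rewrite hA.
    by rewrite /h ltnn /A'' eqxx.
  rewrite IHk// (bigD1 i0)//= mulrC EFinM; congr (_%:E * _)%E.
    by apply: eq_bigr => i ii0; rewrite eA.
  rewrite /e ltnn /A'' eqxx fineK// fin_num_measure//; exact: pre.
Qed.

End independence.

(** * Exponential moments and the Chernoff bound *)

Section chernoff.
Context {dO d1 : measure_display} {Omega : measurableType dO} {T : measurableType d1}
  {R : realType} {P : probability Omega R}.

Lemma integrable_of_bounded (f : Omega -> R) (b : R) :
  measurable_fun setT f -> (forall w, `|f w| <= b) -> P.-integrable setT (EFin \o f).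
Proof.
move=> mf fb; apply: measurable_bounded_integrable => //.
  by apply: le_lt_trans (probability_le1 P measurableT) _; exact: ltry.
exists b; split; first exact: num_real.
by move=> x bx w _ /=; exact: le_trans (fb w) (ltW bx).
Qed.

(* From [exp (- y) >= 1 - y] with [y = x / 2]. *)
Lemma expR_le_quadratic (x : R) : `|x| <= 3 / 8 -> expR x <= 1 + x + x ^+ 2.
Proof.
move=> x38; set y := x / 2.
have [y1 y2] : - 3 / 16 <= y /\ y <= 3 / 16.
  by move: x38; rewrite ler_norml /y => /andP[? ?]; split; lra.
have -> : expR x = (expR (- y))^-1 ^+ 2 by rewrite -expRN opprK -expRM_natl /y; congr expR; field.
have h : 1 - y <= expR (- y) by exact: expR_ge1Dx.
have y10 : 0 < 1 - y by lra.
apply: (@le_trans _ _ ((1 - y)^-1 ^+ 2)).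
  by rewrite ler_pXn2r// ?nnegrE ?invr_ge0 ?expR_ge0 ?(ltW y10)// lef_pV2// posrE expR_gt0.
rewrite exprVn -[leLHS]mul1r ler_pdivrMr ?exprn_gt0//.
have -> : x = 2 * y by rewrite /y; field.
(* This is [(1 + 2y + 4y^2) (1 - y)^2 - 1]. Its second factor is positive for [y] below
   [(3 - sqrt 5) / 4], slightly above [3 / 16]; hence the range [3 / 8] for [x]. *)
have : 0 <= y ^+ 2 * (1 - 6 * y + 4 * y ^+ 2).
  rewrite mulr_ge0 ?sqr_ge0//; have := sqr_ge0 (y - 3 / 16); rewrite !expr2; lra.
rewrite !expr2; lra.
Qed.

(** Integrate the quadratic bound on the exponential, then apply [1 + x <= expR x]. Using the second
    moment instead of the variance avoids centring [g]. *)
Lemma mgf_bound (g : Omega -> R) (b u m v : R) :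
  measurable_fun setT g -> (forall w, `|g w| <= b) -> 0 <= u -> u * b <= 3 / 8 ->
  \int[P]_w g w <= m -> \int[P]_w (g w ^+ 2) <= v ->
  \int[P]_w expR (u * g w) <= expR (u * m + u ^+ 2 * v).
Proof.
move=> mg gb u0 ub Em Ev.
have ugb w : `|u * g w| <= 3 / 8.
  by rewrite normrM ger0_norm// (le_trans _ ub)// ler_wpM2l.
have mug : measurable_fun setT (fun w => u * g w) by exact: measurable_funM.
have ig : P.-integrable setT (EFin \o g) by exact: integrable_of_bounded mg gb.
have mg2 : measurable_fun setT (fun w => g w ^+ 2) by exact: measurable_funX.
have ig2 : P.-integrable setT (EFin \o (fun w => g w ^+ 2)).
  apply: (@integrable_of_bounded _ (b ^+ 2)) => // w.
  by rewrite normrX ler_pXn2r ?nnegrE// (le_trans _ (gb w)).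
have iZ (c : R) (k : Omega -> R) : P.-integrable setT (EFin \o k) ->
    P.-integrable setT (EFin \o (fun w => c * k w)).
  by move=> ik; exact: (integrableZl measurableT c ik).
have i1 : P.-integrable setT (EFin \o (fun=> 1 : R)).
  by apply: (@integrable_of_bounded _ 1) => // w; rewrite normr1.
have iD (k l : Omega -> R) : P.-integrable setT (EFin \o k) ->
    P.-integrable setT (EFin \o l) -> P.-integrable setT (EFin \o (fun w => k w + l w)).
  by move=> ik il; exact: (integrableD measurableT ik il).
have iq : P.-integrable setT (EFin \o (fun w => 1 + u * g w)) by apply: iD => //; exact: iZ.
apply: (@le_trans _ _ (\int[P]_w (1 + u * g w + u ^+ 2 * g w ^+ 2))).
  apply: le_Rintegral => //.
  - apply: (@integrable_of_bounded _ (expR (3 / 8))).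
      exact: (measurableT_comp (@measurable_expR R) mug).
    move=> w; rewrite ger0_norm ?expR_ge0// ler_expR (le_trans (ler_norm _))//.
  - by apply: iD => //; exact: iZ.
  - by move=> w _; rewrite -exprMn; exact: expR_le_quadratic.
rewrite RintegralD//; last exact: iZ.
rewrite RintegralD//; last exact: iZ.
rewrite !RintegralZl// Rintegral_cst//.
rewrite [X in 1 * X](_ : _ = 1) ?mulr1; last exact: (congr1 fine (probability_setT P)).
apply: le_trans (expR_ge1Dx _); rewrite addrA lerD ?lerD2l// ler_wpM2l//.
by rewrite exprn_ge0.
Qed.

Lemma same_law_ge0_integral (V1 V2 : Omega -> T) (g : T -> R) :
  measurable_fun setT V1 -> measurable_fun setT V2 -> same_law P V1 V2 ->
  measurable_fun setT g -> (forall z, 0 <= g z) ->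
  (\int[P]_w (g (V1 w))%:E = \int[P]_w (g (V2 w))%:E)%E.
Proof.
move=> mV1 mV2 H12 mg g0.
pose W1 : {RV P >-> T} := mfun_Sub (mem_set mV1).
pose W2 : {RV P >-> T} := mfun_Sub (mem_set mV2).
have mEg : measurable_fun setT (EFin \o g) by exact/measurable_EFinP.
have Eg0 z : (0 <= (EFin \o g) z)%E by rewrite lee_fin.
have e1 := ge0_integral_distribution W1 mEg Eg0.
have e2 := ge0_integral_distribution W2 mEg Eg0.
transitivity (\int[distribution P W1]_z (EFin \o g) z)%E; first by rewrite e1.
transitivity (\int[distribution P W2]_z (EFin \o g) z)%E; last by rewrite e2.
by apply: eq_measure_integral => A mA _; exact: H12.
Qed.

Lemma iid_chernoff (n : nat) (Z : 'I_n -> {RV P >-> T}) (V : Omega -> T)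
    (g : T -> R) (b u m v t : R) :
  (0 < n)%N -> measurable_fun setT V ->
  iid_copies P (fun i => Z i : Omega -> T) V ->
  measurable_fun setT g -> (forall z, `|g z| <= b) -> 0 <= u -> u * b <= 3 / 8 ->
  \int[P]_w g (V w) <= m -> \int[P]_w (g (V w) ^+ 2) <= v ->
  (P [set w | (m + t <= avg (fun i => g (Z i w)))%R]
    <= (expR (n%:R * (u ^+ 2 * v - u * t)))%:E)%E.
Proof.
move=> n0 mV [indep law] mg gb u0 ub Em Ev.
have mexp : measurable_fun setT (fun z => expR (u * g z)).
  by apply: (measurableT_comp (@measurable_expR R)); exact: measurable_funM.
have mgV : measurable_fun setT (g \o V) by exact: measurableT_comp.
have mgf := mgf_bound mgV (fun w => gb (V w)) u0 ub Em Ev.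
set mu := (\int[P]_w expR _) in mgf.
have iE : P.-integrable setT (EFin \o (fun w => expR (u * g (V w)))).
  apply: (@integrable_of_bounded _ (expR (u * b))).
    exact: (measurableT_comp mexp mV).
  move=> w; rewrite ger0_norm ?expR_ge0// ler_expR ler_wpM2l//.
  exact: le_trans (ler_norm _) (gb _).
have Emu i : (\int[P]_w (expR (u * g (Z i w)))%:E = mu%:E)%E.
  have mZ : measurable_fun setT (Z i) by [].
  rewrite (same_law_ge0_integral mZ mV (law i) mexp (fun z => expR_ge0 _)).
  by rewrite fineK//; exact: integrable_fin_num iE.
have mu0 : 0 <= mu by apply: Rintegral_ge0 => w _; exact: expR_ge0.
have Eprod := expectation_prod_iid indep mexp (fun z => expR_ge0 _) mu0 Emu.
set S := [set w | _].
set a := n%:R * (u * (m + t)).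
have n0' : 0 < n%:R :> R by rewrite ltr0n.
have mS : measurable S.
  have mavg : measurable_fun setT (fun w => avg (fun i => g (Z i w))).
    apply: measurable_funM => //; apply: measurable_sum => i.
    exact: measurableT_comp.
  rewrite -[S]setTI (_ : S = (fun w => avg (fun i => g (Z i w))) @^-1` `[m + t, +oo[).
    exact: mavg.
  by apply/seteqP; split => w; rewrite /S /= in_itv/= andbT.
(* Markov's inequality: on [S] the product of the [expR (u * g (Z i w))] is at least [expR a], and
   its expectation is [mu ^+ n]. *)
have pS : ((expR a)%:E * P S <= (mu ^+ n)%:E)%E.
  have mI : measurable_fun setT (fun w => (\1_S w : R)%:E).
    exact/measurable_EFinP/measurable_indic.
  have -> : P S = (\int[P]_w (\1_S w)%:E)%E by rewrite integral_indic// setIT.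
  rewrite -Eprod -ge0_integralZl//.
  apply: ge0_le_integral => //.
  - by apply: measurable_funeM; exact/measurable_EFinP/measurable_indic.
  - apply/measurable_EFinP; apply: measurable_prod => i _; exact: (measurableT_comp mexp).
  - move=> w _; rewrite -EFinM lee_fin indicE.
    case: (boolP (w \in S)) => [/set_mem|] wS; last first.
      by rewrite mulr0 prodr_ge0// => i _; exact: expR_ge0.
    rewrite mulr1 -expR_sum ler_expR -mulr_sumr /a mulrCA ler_wpM2l//.
    by rewrite mulrC -ler_pdivlMr// mulrC.
have PSfin : P S \is a fin_num by rewrite fin_num_measure.
rewrite -(fineK PSfin) lee_fin in pS *.
move: pS; rewrite -ler_pdivlMl ?expR_gt0// => pS.
apply: (le_trans pS); rewrite -expRN.
apply: (@le_trans _ _ (expR (- a) * expR (u * m + u ^+ 2 * v) ^+ n)).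
  by rewrite ler_wpM2l ?expR_ge0// ler_pXn2r// nnegrE ?expR_ge0.
by rewrite -expRM_natl -expRD ler_expR /a le_eqVlt; apply/orP; left; apply/eqP; ring.
Qed.

End chernoff.

(** * Measurability of the sign recovery event *)

Section row_vectors.
Context {R : realType} {M : nat}.
Implicit Types v theta : 'rV[R]_M.

Lemma rV_norm_leP v (r : R) : 0 <= r -> `|v| <= r <-> forall j, `|v 0 j| <= r.
Proof.
move=> r0; have -> : `|v| = \big[Num.max/0]_ij `|v ij.1 ij.2| := mx_normrE v.
split.
  by move=> /bigmax_leP[_ h] j; exact: (h (0, j)).
by move=> h; apply/bigmax_leP; split => // -[i j] _ /=; rewrite ord1.
Qed.

(** [A] may contain no rational point. For each rational centre and each radius [1 / (m + 1)], a
    point of [A] that close is picked if there is one; [x0] is the default. *)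
Lemma dense_sequence (A : set 'rV[R]_M) : A !=set0 ->
  exists D : nat -> 'rV[R]_M, (forall k, A (D k)) /\
    forall theta, A theta -> forall e : R, 0 < e -> exists k, `|D k - theta| < e.
Proof.
move=> [x0 Ax0].
pose near_pt (c : 'rV[rat]_M * nat) : set 'rV[R]_M :=
  [set x | A x /\ `|map_mx ratr c.1 - x| <= c.2.+1%:R^-1].
pose pick_pt c := if pselect (near_pt c !=set0) is left h then projT1 (cid h) else x0.
pose D k := if unpickle k is Some c then pick_pt c else x0.
exists D; split=> [k|theta Atheta e e0].
  rewrite /D; case: unpickle => // c; rewrite /pick_pt; case: pselect => // h.
  by case: (projT2 (cid h)).
pose m := Num.truncn (2 / e).
have me : m.+1%:R^-1 < e / 2.
  rewrite -[e / 2]invrK ltf_pV2 ?posrE ?invr_gt0 ?divr_gt0// invf_div.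
  exact: truncnS_gt.
have q j : exists q : rat, `|ratr q - theta 0 j| <= m.+1%:R^-1.
  have : theta 0 j - m.+1%:R^-1 < theta 0 j + m.+1%:R^-1.
    by rewrite ltrD2l gt0_cp.
  move=> /rat_in_itvoo[q]; rewrite in_itv/= => /andP[q1 q2]; exists q.
  by rewrite ler_distl !ltW.
pose Q : 'rV[rat]_M := \row_j projT1 (cid (q j)).
have Qtheta : near_pt (Q, m) theta.
  split=> //=; apply/rV_norm_leP; first by rewrite invr_ge0.
  by move=> j; rewrite !mxE; exact: projT2 (cid (q j)).
exists (pickle (Q, m)); rewrite /D pickleK /pick_pt.
case: pselect => [h|]; last by case; exists theta.
case: (cid h) => x /= [_ /= h1].
case: Qtheta => /= _ h2.
have -> : x - theta = (map_mx ratr Q - theta) - (map_mx ratr Q - x).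
  by rewrite opprB [RHS]addrC subrKA.
apply: (le_lt_trans (ler_normB _ _)); rewrite [e]splitr.
by apply: ltrD; [exact: le_lt_trans h2 me|exact: le_lt_trans h1 me].
Qed.

Lemma continuous_sum {T : topologicalType} {I : Type} (r : seq I) (P : pred I)
    (F : I -> T -> R) : (forall i, continuous (F i)) ->
  continuous (fun x => \sum_(i <- r | P i) F i x).
Proof. by move=> cF; apply: continuous_big => //; exact: add_continuous. Qed.

Lemma l1norm_continuous : continuous (@l1norm R M).
Proof.
apply: continuous_sum => j theta.
apply: (@continuous_comp _ _ _ (fun v : 'rV[R]_M => v 0 j) (@Num.norm _ R)).
  exact: coord_continuous.
exact: norm_continuous.
Qed.

Lemma norm_le_l1norm theta : `|theta| <= l1norm theta.
Proof.
apply/rV_norm_leP; first exact: sumr_ge0.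
by move=> j; rewrite /l1norm (bigD1 j)//= lerDl sumr_ge0.
Qed.

Lemma l1_ball_compact (C : set 'rV[R]_M) (a : R) : closed C ->
  compact (C `&` [set theta | l1norm theta <= a]).
Proof.
move=> cC; apply: bounded_closed_compact; last first.
  apply: closedI => //.
  apply: (@preimage_closed _ _ (@l1norm R M) [set x : R | x <= a]); [|exact: closed_le].
  by move=> ? ?; exact: l1norm_continuous.
exists a; split; first exact: num_real.
move=> x ax theta [_ /= h]; exact: le_trans (norm_le_l1norm _) (le_trans h (ltW ax)).
Qed.

End row_vectors.

(** * Measurability of events about l1 minimizers under a random constraint *)

Section measurable_argmin.
Context {R : realType} {M : nat} {d : measure_display} {Omega : measurableType d}.
Variable h : Omega -> 'rV[R]_M -> R.
Hypothesis mh : forall theta, measurable_fun setT (h ^~ theta).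
Hypothesis ch : forall w, continuous (h w).

(** On a compact set [h w] attains its minimum, so a point with [h w theta <= 0] exists exactly when
    the infimum along a dense sequence is at most 0, a countable condition. *)
Lemma measurable_exists_le0 (A : set 'rV[R]_M) : compact A ->
  measurable [set w | exists theta, A theta /\ h w theta <= 0].
Proof.
move=> cA; have [->|/set0P A0] := eqVneq A set0.
  by rewrite (_ : [set _ | _] = set0)//; apply/seteqP; split => w // -[? []].
have [D [DA Dd]] := dense_sequence A0.
have -> : [set w | exists theta, A theta /\ h w theta <= 0] =
    \bigcap_m \bigcup_k [set w | h w (D k) < m.+1%:R^-1].
  apply/seteqP; split => w /=.
    move=> [theta [Atheta h0]] m _.
    have e0 : 0 < m.+1%:R^-1 :> R by rewrite invr_gt0.
    have /cvgrPdist_lt/(_ _ e0) /nbhs_ballP[e /= e0' he] := @ch w theta.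
    have [k Dk] := Dd _ Atheta _ e0'.
    exists k => //=.
    have : ball theta e (D k) by rewrite mx_norm_ball /ball_ /= distrC.
    move=> /he /=; rewrite ltr_distlC => /andP[_ h2].
    by rewrite (lt_le_trans h2)// gerDr.
  move=> hw.
  have cw : {within A, continuous (h w)} by exact: continuous_subspaceT.
  have [c cA' hmin] := compact_EVT_min A0 cA cw.
  move/set_mem in cA'.
  exists c; split => //; apply/ler_addgt0Pl => e e0; rewrite addr0.
  pose m := Num.truncn e^-1.
  have [k _ /= hk] := hw m Logic.I.
  have := hmin (D k) (mem_set (DA k)).
  move=> /le_trans; apply; apply: (le_trans (ltW hk)).
  by rewrite -[e]invrK lef_pV2 ?posrE ?invr_gt0// ltW// truncnS_gt.
apply: bigcapT_measurable => m; apply: bigcupT_measurable => k.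
rewrite -[X in measurable X]setTI
  (_ : [set w | _] = (h ^~ (D k)) @^-1` `]-oo, m.+1%:R^-1[%classic).
  exact: mh.
by apply/seteqP; split => w /=; rewrite in_itv.
Qed.

Variable Th : set 'rV[R]_M.
Hypothesis closedTh : closed Th.

Definition constrained w : set 'rV[R]_M := [set theta | Th theta /\ h w theta <= 0].

Definition l1_argmin w : set 'rV[R]_M :=
  [set theta | constrained w theta /\
     forall theta', constrained w theta' -> l1norm theta <= l1norm theta'].

(* [Ex C a] is the event that a feasible point of l1 norm at most [a] lies in
   [C]; a minimizer lies in [C] when [Ex Th a] implies [Ex (Th `&` C) a] for
   every rational [a]. *)
Lemma measurable_argmin_meets (C : set 'rV[R]_M) : closed C ->
  measurable [set w | exists theta, l1_argmin w theta /\ C theta].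
Proof.
move=> cC.
pose Ex (C : set 'rV[R]_M) (a : R) : set Omega :=
  [set w | exists theta, (C `&` [set theta | l1norm theta <= a]) theta /\ h w theta <= 0].
have mEx C' a : closed C' -> measurable (Ex C' a).
  by move=> cC'; apply: measurable_exists_le0; exact: l1_ball_compact.
have -> : [set w | exists theta, l1_argmin w theta /\ C theta] =
    (\bigcup_N Ex (Th `&` C) N%:R) `&`
    \bigcap_(q : rat) (~` Ex Th (ratr q) `|` Ex (Th `&` C) (ratr q)).
  apply/seteqP; split => w /=.
    move=> [theta [[[Tt ht] mint] Ct]]; split.
      exists (Num.truncn (l1norm theta)).+1 => //=.
      by exists theta; do !split => //=; rewrite ltW// truncnS_gt.
    move=> q _; case: (pselect (Ex Th (ratr q) w)) => [|nE]; last by left.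
    move=> [theta' /= [[Tt' lt'] ht']]; right; exists theta => /=.
    by do !split => //; apply: le_trans lt'; exact: mint.
  move=> [[N _ [theta0 /= [[[T0 C0] l0] h0]]] hq].
  pose B := (Th `&` C) `&` [set theta | l1norm theta <= N%:R] `&` [set theta | h w theta <= 0].
  have B0 : B !=set0 by exists theta0; do !split.
  have cB : compact B.
    rewrite /B -setIA [X in _ `&` X]setIC setIA; apply: l1_ball_compact.
    apply: closedI; first exact: closedI.
    apply: (@preimage_closed _ _ (h w) [set x : R | x <= 0]); [|exact: closed_le].
    by move=> ? ?; exact: ch.
  have cl : {within B, continuous (@l1norm R M)}.
    exact/continuous_subspaceT/l1norm_continuous.
  have [c /set_mem [[[Tc Cc] lc] hc] minc] := compact_EVT_min B0 cB cl.
  exists c; split => //; split => // theta' [Tt' ht'].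
  (* A feasible point of smaller norm leaves room for a rational [q]; its event provides a feasible
     point of [C] below the minimum [c]. *)
  rewrite leNgt; apply/negP => ltc.
  have [q] := rat_in_itvoo ltc; rewrite in_itv/= => /andP[q1 q2].
  case: (hq q Logic.I) => [[]|]; first by exists theta'; do !split => //; exact: ltW.
  move=> [theta1 /= [[[T1 C1] l1] h1]].
  have : theta1 \in B.
    apply/mem_set; do !split => //=.
    by apply: (le_trans l1); apply: (le_trans (ltW q2)).
  move=> /minc; rewrite leNgt => /negP; apply.
  exact: le_lt_trans l1 q2.
apply: measurableI.
  apply: bigcupT_measurable => N; apply: mEx; exact: closedI.
rewrite -[X in measurable X]setCK setC_bigcap; apply: measurableC.
apply: countable_bigcupT_measurable => [|q]; first exact: countableP.
apply/measurableC/measurableU; first by apply: measurableC; exact: mEx.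
by apply: mEx; exact: closedI.
Qed.

End measurable_argmin.

(** * The parameter set, the gradient constraint and the recovery event *)

Section model.
Context {R : realType} {d M : nat} {dO : measure_display} {Omega : measurableType dO}
  {P : probability Omega R}.
Variables (K alpha L : R).
Hypotheses (K0 : 0 < K) (alpha0 : 0 < alpha).
Variable X : {RV P >-> d.-tuple R}.
Variable f : 'I_M -> {mfun d.-tuple R >-> R}.
Local Notation B := (2 * K + alpha).
Local Notation Theta := (Theta K f X).

Let B0 : 0 <= B.
Proof. by pose proof K0; pose proof alpha0; lra. Qed.

Lemma norm_infty_leP (g : d.-tuple R -> R) (k : R) :
  (norm_infty X g <= k%:E)%E <-> {ae distribution P X, forall x, `|g x| <= k}.
Proof.
rewrite /norm_infty Lnorm.unlock /= probability_setT lte01.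
split=> [/ess_supP|h]; first by apply: filterS => x /=; rewrite lee_fin.
by apply/ess_supP; apply: filterS h => x /=; rewrite lee_fin.
Qed.

Lemma measurable_lincomb theta : measurable_fun setT (lincomb f theta).
Proof. by apply: measurable_sum => j; exact: measurable_funM. Qed.

Lemma continuous_lincomb x : continuous (fun theta => lincomb f theta x).
Proof.
apply: continuous_sum => j theta; apply: continuousM.
  exact: coord_continuous.
exact: cst_continuous.
Qed.

Lemma lincomb_le_closure (A : set 'rV[R]_M) (D : nat -> 'rV[R]_M) x :
  (forall theta, A theta -> forall e : R, 0 < e -> exists k, `|D k - theta| < e) ->
  (forall k, `|lincomb f (D k) x| <= K) ->
  forall theta, closure A theta -> `|lincomb f theta x| <= K.
Proof.
move=> Dd Dx theta cT; pose C := [set theta | `|lincomb f theta x| <= K].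
have cC : closed C.
  apply: (@preimage_closed _ _ (fun theta => `|lincomb f theta x|) [set y : R | y <= K]).
    move=> theta' _; apply: (@continuous_comp _ _ _ ((lincomb f)^~ x) (@Num.norm _ R)).
      exact: continuous_lincomb.
    exact: norm_continuous.
  exact: closed_le.
suff AC : A `<=` C by apply: cC; exact: closureS cT.
move=> theta' T'; apply: cC => U /nbhs_ballP[e /= e0 eU].
have [k Dk] := Dd _ T' _ e0; exists (D k); split; first exact: Dx.
by apply: eU; rewrite mx_norm_ball /ball_ /= distrC.
Qed.

(** Each parameter has its own null set and there are uncountably many. A dense sequence has a
    common null set, off which continuity in [theta] extends the bound to the closure; this also
    makes [Theta] closed. *)
Lemma Theta_uniform_ae :
  {ae distribution P X, forall x theta, closure Theta theta -> `|lincomb f theta x| <= K}.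
Proof.
have [T0|T0] := pselect (Theta !=set0); last first.
  have -> : Theta = set0 by apply/eqP/negP => /negP/set0P.
  by rewrite closure0; exact: aeW.
have [D [DT Dd]] := dense_sequence T0.
have : {ae distribution P X, forall x, forall k, `|lincomb f (D k) x| <= K}.
  by apply: ae_foralln => k; apply/norm_infty_leP; exact: DT.
by apply: filterS => x Dx; exact: lincomb_le_closure Dd Dx.
Qed.

Lemma closed_Theta : closed Theta.
Proof.
move=> theta cT; apply/norm_infty_leP.
by apply: filterS Theta_uniform_ae => x; exact.
Qed.

Lemma good_points : (forall j, (norm_infty X (f j) <= L%:E)%E) ->
  exists G : set (d.-tuple R), [/\ measurable G, P (X @^-1` ~` G) = 0%E &
    forall x, G x -> (forall j, `|f j x| <= L) /\
      forall theta, Theta theta -> `|lincomb f theta x| <= K].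
Proof.
move=> fL.
have : {ae distribution P X, forall x, (forall j, `|f j x| <= L) /\
    forall theta, Theta theta -> `|lincomb f theta x| <= K}.
  have fL' : {ae distribution P X, forall x, forall j, `|f j x| <= L}.
    by apply: filter_forall => j; apply/norm_infty_leP.
  apply: filterS2 fL' Theta_uniform_ae => x fx Tx; split => // theta T.
  exact/Tx/subset_closure.
move=> [N [mN N0 NS]]; exists (~` N); split; rewrite ?setCK//.
  exact: measurableC.
by move=> x Nx; apply: contrapT => h; apply: Nx; exact: NS.
Qed.

Lemma continuous_clamp : continuous (@clamp R B).
Proof.
move=> x; apply/cvgrPdist_lt => e e0; near=> y.
apply: (le_lt_trans (clamp_lipschitz _ _ B0)).
by near: y; exact: cvgr_dist_lt.
Unshelve. all: by end_near. Qed.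

Lemma measurable_score theta j : measurable_fun setT (score K alpha f theta j).
Proof.
apply: measurable_funM; last exact: measurableT_comp.
apply: measurableT_comp; first exact: continuous_measurable_fun continuous_clamp.
apply: measurable_funB; first exact: measurable_snd.
by apply: measurableT_comp measurable_fst; exact: measurable_lincomb.
Qed.

Lemma continuous_score j z : continuous (fun theta => score K alpha f theta j z).
Proof.
move=> theta.
apply: (@continuousM R 'rV[R]_M (fun t => clamp B (z.2 - lincomb f t z.1)) (fun=> f j z.1));
  last exact: cst_continuous.
apply: (@continuous_comp _ _ _ (fun t => z.2 - lincomb f t z.1) (@clamp R B)).
  apply: (@continuousB R R 'rV[R]_M (fun=> z.2) (fun t => lincomb f t z.1)).
    exact: cst_continuous.
  exact: continuous_lincomb.
exact: continuous_clamp.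
Qed.

Context {n : nat}.
Implicit Type z : 'I_n -> d.-tuple R * R.

(** The [M] gradient constraints become one inequality [violation <= 0] for a function continuous in
    [theta], the form required by [l1_argmin]. *)
Definition violation (r : R) z theta : R :=
  \sum_(j < M) Num.max 0 (`|avg (fun i => score K alpha f theta j (z i))| - r).

Lemma feasibleE (r : R) z : 0 <= r ->
  feasible K alpha f X r z = [set theta | Theta theta /\ violation r z theta <= 0].
Proof.
move=> r0; apply/seteqP; split => theta /= [T h]; split => //.
  rewrite /violation big1// => j _; apply/max_idPl; rewrite subr_le0.
  by move: h => /rV_norm_leP -/(_ r0 j); rewrite grad_emp_risk// normrN.
apply/rV_norm_leP => // j; rewrite grad_emp_risk// normrN -subr_le0.
apply: le_trans h; rewrite /violation (bigD1 j)//=.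
apply: (@le_trans _ _ (Num.max 0 (`|avg (fun i => score K alpha f theta j (z i))| - r))).
  by rewrite le_max lexx orbT.
by rewrite lerDl sumr_ge0// => k _; rewrite le_max lexx.
Qed.

Lemma continuous_violation r z : continuous (violation r z).
Proof.
apply: continuous_sum => j theta.
apply: (@continuous_max R 'rV[R]_M (fun=> 0)
  (fun t => `|avg (fun i => score K alpha f t j (z i))| - r)); first exact: cst_continuous.
apply: (@continuousB R R 'rV[R]_M (fun t => `|avg (fun i => score K alpha f t j (z i))|)
  (fun=> r)); last exact: cst_continuous.
apply: (@continuous_comp _ _ _ (fun t => avg (fun i => score K alpha f t j (z i))) (@Num.norm _ R)).
  apply: (@continuousM R 'rV[R]_M (fun=> n%:R^-1)
    (fun t => \sum_(i < n) score K alpha f t j (z i))); first exact: cst_continuous.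
  by apply: continuous_sum => i; exact: continuous_score.
exact: norm_continuous.
Qed.

Variable Z : 'I_n -> {RV P >-> (d.-tuple R * R)%type}.

Lemma measurable_violation r theta :
  measurable_fun setT (fun w => violation r (fun i => Z i w) theta).
Proof.
apply: measurable_sum => j; apply: measurable_maxr => //.
apply: measurable_funB => //; apply: measurableT_comp => //.
apply: measurable_funM => //; apply: measurable_sum => i.
by apply: measurableT_comp => //; exact: measurable_score.
Qed.

(* A measure of the library takes unspecified values on nonmeasurable sets, so
   the measurability of this uncountable intersection has to be proved.  The sets
   [C j m] are closed and their union over [m] is the set of vectors whose
   thresholded version has the wrong [j]-th sign. *)
Lemma measurable_sign_recovery (r t : R) (thetas : 'rV[R]_M) : 0 <= r -> 0 <= t ->
  measurable [set w | forall ttheta : 'rV[R]_M,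
    Theta_tilde K alpha f X r t (fun i => Z i w) ttheta ->
    sign_vec ttheta = sign_vec thetas].
Proof.
move=> r0 t0.
pose C (j : 'I_M) (m : nat) : set 'rV[R]_M :=
  if Num.sg (thetas 0 j) == 1 then [set theta | theta 0 j <= t]
  else if Num.sg (thetas 0 j) == -1 then [set theta | - t <= theta 0 j]
  else [set theta | t + m.+1%:R^-1 <= `|theta 0 j|].
have cC j m : closed (C j m).
  rewrite /C; case: ifP => _; [|case: ifP => _].
  - apply: (@preimage_closed _ _ (fun v : 'rV[R]_M => v 0 j) [set y : R | y <= t]).
      by move=> *; exact: coord_continuous.
    exact: closed_le.
  - apply: (@preimage_closed _ _ (fun v : 'rV[R]_M => v 0 j) [set y : R | - t <= y]).
      by move=> *; exact: coord_continuous.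
    exact: closed_ge.
  - apply: (@preimage_closed _ _ (fun v : 'rV[R]_M => `|v 0 j|)
              [set y : R | t + m.+1%:R^-1 <= y]); last exact: closed_ge.
    move=> v _; apply: (@continuous_comp _ _ _ (fun v : 'rV[R]_M => v 0 j) (@Num.norm _ R)).
      exact: coord_continuous.
    exact: norm_continuous.
pose h w theta := violation r (fun i => Z i w) theta.
have -> : [set w | forall ttheta : 'rV[R]_M,
    Theta_tilde K alpha f X r t (fun i => Z i w) ttheta ->
    sign_vec ttheta = sign_vec thetas] =
  ~` \bigcup_(j : 'I_M) \bigcup_m
      [set w | exists theta, l1_argmin h Theta w theta /\ C j m theta].
  have argminE w : Theta_hat K alpha f X r (fun i => Z i w) = l1_argmin h Theta w.
    by rewrite /Theta_hat /l1_argmin /constrained feasibleE.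
  have badP theta j : Num.sg (threshold t theta 0 j) != Num.sg (thetas 0 j) <->
      exists m, C j m theta.
    rewrite /C; have [->|s1] := eqVneq (Num.sg (thetas 0 j)) 1.
      rewrite mxE.
      split.
        move=> sg; exists 0%N => /=; rewrite leNgt; apply/negP => th.
        by move: sg; rewrite (lt_le_trans th (ler_norm _)) gtr0_sg ?eqxx// (le_lt_trans t0).
      move=> [_ /= th]; case: ifP => [|_]; last by rewrite sgr0 eq_sym oner_eq0.
      rewrite ltr_normr [t < theta 0 j]ltNge th/= => tN.
      by rewrite ltr0_sg; [apply/eqP; lra|lra].
    have [->|s2] := eqVneq (Num.sg (thetas 0 j)) (- 1).
      rewrite mxE; split.
        move=> sg; exists 0%N => /=; rewrite leNgt; apply/negP => th.
        have tN : t < `|theta 0 j| by rewrite ltr_normr orbC ltrNr th.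
        by move: sg; rewrite tN ltr0_sg ?eqxx//; lra.
      move=> [_ /= th]; case: ifP => [|_]; last by rewrite sgr0 eq_sym oppr_eq0 oner_eq0.
      rewrite ltr_normr [X in _ || X]ltrNr [X in _ || X]ltNge th orbF => tp.
      by rewrite gtr0_sg; [apply/eqP; lra|lra].
    have -> : Num.sg (thetas 0 j) = 0.
      by move: s1 s2; case: sgrP => _ //; rewrite ?eqxx.
    rewrite mxE; split.
      case: ifP => [tt _|_]; last by rewrite sgr0 eqxx.
      exists (Num.truncn (`|theta 0 j| - t)^-1) => /=.
      rewrite -lerBrDl -[leRHS]invrK lef_pV2 ?posrE ?invr_gt0 ?subr_gt0// ltW//.
      exact: truncnS_gt.
    move=> [m /= tm]; have tt : t < `|theta 0 j|.
      by apply: lt_le_trans tm; rewrite ltrDl invr_gt0.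
    by rewrite tt sgr_eq0 -normr_gt0 (le_lt_trans t0).
  apply/seteqP; split => w /=.
    move=> hw [j _ [m _ [theta [am Cm]]]].
    have /badP/eqP : exists m, C j m theta by exists m.
    apply; have /hw/matrixP/(_ 0 j) : Theta_tilde K alpha f X r t (fun i => Z i w) (threshold t theta).
      by exists theta => //; rewrite argminE.
    by rewrite !mxE.
  move=> hw _ [theta + <-]; rewrite argminE => am.
  apply/rowP => j; rewrite [LHS]mxE [RHS]mxE; apply/eqP/negPn/negP => /badP[m Cm].
  by apply: hw; exists j => //; exists m => //; exists theta.
apply: measurableC; apply: fin_bigcup_measurable => // j _.
apply: bigcupT_measurable => m; apply: measurable_argmin_meets => //.
- by move=> theta; exact: measurable_violation.
- by move=> w; exact: continuous_violation.
- exact: closed_Theta.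
Qed.

End model.

(** * Sign recovery on the good event *)

Section recovery.
Context {R : realType} {d M n : nat} {dO : measure_display} {Omega : measurableType dO}
  {P : probability Omega R}.
Variables (K alpha L beta p q : R) (s : nat).
Variable X : {RV P >-> d.-tuple R}.
Variable f : 'I_M -> {mfun d.-tuple R >-> R}.
Variables (thetas : 'rV[R]_M) (z : 'I_n -> d.-tuple R * R).
Local Notation B := (2 * K + alpha).
Local Notation Theta := (Theta K f X).
Local Notation rate := (@rate R n M).
Local Notation r := (rpar K alpha L n M).
Local Notation c4 := (C4 K L beta p q n s).
Local Notation t := (L * l1_radius K alpha L beta p n M s).
Let w i := (z i).2 - lincomb f thetas (z i).1.
Let F i j := f j (z i).1.

(** Since the l1 norm has not grown, the mass gained off the support is at most the mass lost on it,
    hence at most the change there. *)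
Lemma cone_condition (theta : 'rV[R]_M) : l1norm theta <= l1norm thetas ->
  \sum_(j in ~: supp thetas) `|theta 0 j - thetas 0 j|
    <= \sum_(j in supp thetas) `|theta 0 j - thetas 0 j|.
Proof.
have splt (g : 'I_M -> R) : \sum_j g j =
    \sum_(j in supp thetas) g j + \sum_(j in ~: supp thetas) g j.
  by rewrite (bigID (mem (supp thetas)))/=; congr (_ + _); apply: eq_bigl => j; rewrite [in RHS]inE.
rewrite /l1norm !splt.
have -> : \sum_(j in ~: supp thetas) `|thetas 0 j| = 0.
  by apply: big1 => j; rewrite !inE negbK => /eqP ->; rewrite normr0.
have -> : \sum_(j in ~: supp thetas) `|theta 0 j - thetas 0 j|
    = \sum_(j in ~: supp thetas) `|theta 0 j|.
  by apply: eq_bigr => j; rewrite !inE negbK => /eqP ->; rewrite subr0.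
have : \sum_(j in supp thetas) `|thetas 0 j| <=
    \sum_(j in supp thetas) `|theta 0 j - thetas 0 j| + \sum_(j in supp thetas) `|theta 0 j|.
  rewrite -big_split; apply: ler_sum => j _.
  by have := ler_normB (theta 0 j) (theta 0 j - thetas 0 j); rewrite subKr addrC.
lra.
Qed.

Lemma sign_recovery :
  (0 < n)%N -> (2 <= M)%N -> (1 <= s)%N ->
  0 < K -> 0 < alpha -> 1 <= L -> 1 < beta ->
  0 < p -> p <= 1 -> 0 < q -> q <= 1 -> q <= 2 * B ->
  s%:R <= (Num.sqrt r)^-1 ->
  12 * L ^+ 3 * eta_par K alpha L beta p n M s + L * rtilde L n M
    + C2 K L beta p s / (Num.sqrt n%:R * s%:R ^+ 2) <= q / 2 ->
  ((2 * c4 * r)%:E < min_abs_supp thetas)%E ->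
  (#|supp thetas| <= s)%N ->
  Theta thetas ->
  (forall i j, `|F i j| <= L) ->
  (forall i theta, Theta theta -> `|lincomb f theta (z i).1| <= K) ->
  (forall j, `|avg (fun i => clamp B (w i) * F i j)| <= 6 * B * rate) ->
  (forall j k, `|wgram F w alpha j k - p *+ (j == k)| <= p * coherence beta s + 6 * L * rate) ->
  (forall j k, `|wgram F w B j k - q *+ (j == k)| <= q * coherence beta s + 6 * L * rate) ->
  avg (fun i => (`| `|w i| - B| <= t)%R%:R) <= 4 * t + 6 * rate ->
  forall ttheta, Theta_tilde K alpha f X r (c4 * r) z ttheta ->
    sign_vec ttheta = sign_vec thetas.
Proof.
move=> n0 M2 s1 K0 a0 L1 b1 p0 p1 q0 q1 qB sr small rho Ms Ts FL FK Hs Ha HB Ht.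
have B0 : 0 <= B by lra.
have L0 : 0 <= L by lra.
have r0 := rpar_gt0 n0 M2 K0 a0 L1.
have ratp : 0 < rate := rate_gt0 n0 M2.
have scoreE theta j : avg (fun i => score K alpha f theta j (z i)) =
    avg (fun i => clamp B (w i - \sum_k (theta 0 k - thetas 0 k) * F i k) * F i j).
  apply: eq_avg => i; rewrite /score; congr (clamp _ _ * _).
  have -> : \sum_k (theta 0 k - thetas 0 k) * F i k = lincomb f (theta - thetas) (z i).1.
    by apply: eq_bigr => k _; rewrite !mxE.
  by rewrite lincombB /w; ring.
have feas : feasible K alpha f X r z thetas.
  split=> //; apply/rV_norm_leP; first exact: ltW.
  move=> j; rewrite grad_emp_risk// normrN.
  by apply: le_trans (Hs j) _; exact: rate_le_rpar.
move=> _ [theta [[Tt gt] /(_ _ feas) l1le] <-].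
pose D j := theta 0 j - thetas 0 j.
have cone := cone_condition l1le.
have hE i : \sum_j D j * F i j = lincomb f theta (z i).1 - lincomb f thetas (z i).1.
  by rewrite -lincombB; apply: eq_bigr => k _; rewrite !mxE.
have grd j : `|avg (fun i => (clamp B (w i) - clamp B (w i - \sum_k D k * F i k)) * F i j)|
    <= 2 * r.
  have -> : avg (fun i => (clamp B (w i) - clamp B (w i - \sum_k D k * F i k)) * F i j)
      = avg (fun i => clamp B (w i) * F i j) - avg (fun i => score K alpha f theta j (z i)).
    by rewrite scoreE avgB; apply: eq_avg => i; rewrite mulrBl.
  apply: (le_trans (ler_normB _ _)); rewrite [leRHS]mulr_natl mulr2n; apply: lerD.
    by apply: le_trans (Hs j) _; exact: rate_le_rpar.
  by move: gt => /rV_norm_leP -/(_ (ltW r0) j); rewrite grad_emp_risk// normrN.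
have coh0 : 0 <= coherence beta s.
  by rewrite invr_ge0 !mulr_ge0//; lra.
have eps0 (x : R) : 0 < x -> 0 <= x * coherence beta s + 6 * L * rate.
  move=> x0; apply: addr_ge0; apply: mulr_ge0 => //; [exact: ltW| |exact: ltW].
  exact: mulr_ge0.
(* Both parameters lie in [Theta], so their predictions differ by at most [2K], which is
   [B - alpha]. *)
have hB i : `|\sum_j D j * F i j| <= B - alpha.
  rewrite hE (le_trans (ler_normB _ _))//.
  by have := FK i _ Tt; have := FK i _ Ts; lra.
have kap0 := compatibility_gt0 n0 M2 s1 K0 a0 L1 b1 p0 p1 q0 q1 qB small.
have l1err : \sum_j `|D j| <= l1_radius K alpha L beta p n M s.
  apply: (l1_radius_ge n0 M2 s1 K0 a0 L1 b1 p0 p1 q0 q1 qB small).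
  apply: (l1_error (ltW a0) _ (ltW p0) (eps0 _ p0) _ s1 Ms cone hB Ha grd kap0).
    by rewrite lerDr mulr_ge0// ltW.
  by rewrite mulr_ge0// ltW.
have rad := sup_radius n0 M2 s1 K0 a0 L1 b1 p0 p1 q0 q1 qB sr small.
have sup j : `|D j| <= c4 * r.
  rewrite -(ler_pM2l q0); apply: le_trans rad.
  have := sup_error B0 L0 (ltW q0) (ler_wpM2l L0 l1err) FL HB Ht grd j.
  move=> /le_trans; apply; rewrite lerD2l; apply: ler_wpM2r => //.
  apply: addr_ge0; first exact: eps0.
  apply: mulr_ge0; first exact: sqr_ge0.
  have rad0 : 0 <= l1_radius K alpha L beta p n M s by apply: le_trans l1err; exact: sumr_ge0.
  by apply: addr_ge0; [exact: (mulr_ge0 (ler0n _ 4) (mulr_ge0 L0 rad0))|lra].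
have rho' j : thetas 0 j != 0 -> 2 * c4 * r < `|thetas 0 j|.
  move=> tj; rewrite -lte_fin; apply: (lt_le_trans rho).
  by apply: bigmin_le_cond; rewrite inE.
apply/rowP => j; rewrite !mxE.
have := sup j; rewrite /D.
(* Each coordinate of the minimizer is within [c4 * r] of the truth. Where the truth is zero it does
   not pass the threshold; where it exceeds twice the threshold it stays above with the same
   sign. *)
have [tj0|/rho'] := eqVneq (thetas 0 j) 0.
  by rewrite tj0 subr0 sgr0 => h; rewrite ltNge h/= sgr0.
move=> h1; rewrite ler_distl => /andP[h2 h3].
have c4r0 : 0 <= c4 * r by apply: le_trans (sup j).
case: (ltP 0 (thetas 0 j)) => tj.
  rewrite gtr0_norm// in h1.
  have tp : c4 * r < theta 0 j by lra.
  by rewrite (lt_le_trans tp (ler_norm _)) !gtr0_sg//; lra.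
rewrite ler0_norm// in h1.
have tp : c4 * r < - theta 0 j by lra.
rewrite ltr_normr tp orbT !ltr0_sg//; lra.
Qed.

End recovery.

(** * Probability of the good event *)

Section pair_independence.
Context {dO d1 : measure_display} {Omega : measurableType dO} {T : measurableType d1}
  {R : realType} {P : probability Omega R}.
Variables (X : {RV P >-> T}) (W : {RV P >-> R}).
Hypothesis indep : independent_rv P X W.

Let integrable_comp (d2 : measure_display) (T2 : measurableType d2) (V : {RV P >-> T2})
    (a : T2 -> R) (c : R) : measurable_fun setT a -> (forall x, `|a x| <= c) ->
  P.-integrable setT (EFin \o (a \o V)).
Proof.
move=> ma ac; apply: (@integrable_of_bounded _ _ _ _ _ c) => [|w]; last exact: ac.
exact: measurableT_comp.
Qed.

Let ge0_expectation_mul (a : R -> R) (b : T -> R) (c1 c2 : R) :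
  measurable_fun setT a -> measurable_fun setT b ->
  (forall x, 0 <= a x <= c1) -> (forall x, 0 <= b x <= c2) ->
  \int[P]_w (a (W w) * b (X w)) = \int[P]_w a (W w) * \int[P]_w b (X w).
Proof.
move=> ma mb a01 b01.
have a0 x : 0 <= a x by case/andP: (a01 x).
have b0 x : 0 <= b x by case/andP: (b01 x).
have maW : measurable_fun setT (a \o W) by exact: measurableT_comp.
have ac x : `|a x| <= c1 by rewrite ger0_norm//; case/andP: (a01 x).
have bc x : `|b x| <= c2 by rewrite ger0_norm//; case/andP: (b01 x).
have pre A : measurable A -> measurable (X @^-1` A).
  by move=> mA; rewrite -[X in measurable X]setTI; exact: measurable_funPT.
have preW A : measurable A -> measurable (W @^-1` A).
  by move=> mA; rewrite -[X in measurable X]setTI; exact: measurable_funPT.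
have EaW : (\int[P]_w (a (W w))%:E = (\int[P]_w a (W w))%:E)%E.
  by rewrite fineK//; exact: integrable_fin_num (integrable_comp W ma ac).
have EbX : (\int[P]_w (b (X w))%:E = (\int[P]_w b (X w))%:E)%E.
  by rewrite fineK//; exact: integrable_fin_num (integrable_comp X mb bc).
(* [ge0_integral_factor] is applied twice. Here [H] is the indicator of [X] in [A] and [V = W]; the
   result is the product rule needed below with [H = a (W)] and [V = X]. *)
have step1 A : measurable A ->
    (\int[P]_w (\1_(X @^-1` A) w * a (W w))%:E
     = (fine (P (X @^-1` A)))%:E * \int[distribution P W]_y (a y)%:E)%E.
  move=> mA; apply: ge0_integral_factor => //.
  - exact/measurable_indic/pre.
  - by rewrite fine_ge0.
  move=> A' mA'.
  have -> : (fun w => (\1_(X @^-1` A) w * \1_A' (W w))%:E) =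
      EFin \o (\1_(X @^-1` A `&` W @^-1` A') : Omega -> R).
    by apply/funext => w /=; rewrite indicI.
  rewrite integral_indic//; last by apply: measurableI; [exact: pre|exact: preW].
  rewrite setIT fineK; last by rewrite fin_num_measure//; exact: pre.
  exact: indep.
suff : (\int[P]_w (a (W w) * b (X w))%:E =
    (\int[P]_w a (W w))%:E * \int[distribution P X]_y (b y)%:E)%E.
  rewrite (@ge0_integral_distribution _ _ _ _ _ _ _ (EFin \o b))//=; last exact/measurable_EFinP.
  by rewrite EbX -EFinM /Rintegral => ->.
apply: ge0_integral_factor => //.
- exact: Rintegral_ge0.
- move=> A mA.
  have := step1 A mA.
  rewrite (@ge0_integral_distribution _ _ _ _ _ _ _ (EFin \o a))//=; last exact/measurable_EFinP.
  rewrite EaW fineK ?fin_num_measure//; last exact: pre.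
  rewrite muleC => <-; apply: eq_integral => w _; congr (_%:E).
  by rewrite mulrC.
Qed.

Lemma expectation_mul_indep (a : R -> R) (b : T -> R) (c1 c2 : R) :
  measurable_fun setT a -> measurable_fun setT b ->
  (forall x, `|a x| <= c1) -> (forall x, `|b x| <= c2) ->
  \int[P]_w (a (W w) * b (X w)) = \int[P]_w a (W w) * \int[P]_w b (X w).
Proof.
move=> ma mb ac bc.
(* Adding the bounds [c1] and [c2] makes both factors nonnegative; expanding the product and
   cancelling recovers the unshifted rule. *)
have E := @ge0_expectation_mul (fun x => a x + c1) (fun x => b x + c2) (c1 + c1) (c2 + c2).
have {E} : \int[P]_w ((a (W w) + c1) * (b (X w) + c2)) =
    \int[P]_w (a (W w) + c1) * \int[P]_w (b (X w) + c2).
  apply: E; [exact: measurable_funD|exact: measurable_funD| |].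
  - by move=> x; have := ac x; rewrite ler_norml => /andP[? ?]; apply/andP; split; lra.
  - by move=> x; have := bc x; rewrite ler_norml => /andP[? ?]; apply/andP; split; lra.
have ia := integrable_comp W ma ac; have ib := integrable_comp X mb bc.
have icst (c : R) : P.-integrable setT (EFin \o (fun=> c)).
  by apply: (@integrable_of_bounded _ _ _ _ _ `|c|).
have iD (k l : Omega -> R) : P.-integrable setT (EFin \o k) ->
    P.-integrable setT (EFin \o l) -> P.-integrable setT (EFin \o (fun w => k w + l w)).
  by move=> ik il; exact: (integrableD measurableT ik il).
have iZ (c : R) (k : Omega -> R) : P.-integrable setT (EFin \o k) ->
    P.-integrable setT (EFin \o (fun w => c * k w)).
  by move=> ik; exact: (integrableZl measurableT c ik).
have iab : P.-integrable setT (EFin \o (fun w => a (W w) * b (X w))).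
  apply: (@integrable_of_bounded _ _ _ _ _ (c1 * c2)).
    by apply: measurable_funM; exact: measurableT_comp.
  by move=> w; rewrite normrM ler_pM.
have cstE (c : R) : \int[P]_w (fun=> c) w = c :> R.
  rewrite Rintegral_cst//.
  by rewrite [X in c * X](_ : _ = 1) ?mulr1//; exact: (congr1 fine (probability_setT P)).
rewrite [X in _ = X * _]RintegralD// [X in _ = _ * X]RintegralD// !cstE.
under eq_Rintegral do rewrite mulrDl !mulrDr addrA.
have iac : P.-integrable setT (EFin \o (fun w => a (W w) * c2)).
  by under eq_fun do rewrite mulrC; exact: (iZ c2 _ ia).
have ibc := iZ c1 _ ib.
rewrite RintegralD//; last exact: (iD _ _ (iD _ _ iab iac) ibc).
rewrite RintegralD//; last exact: (iD _ _ iab iac).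
rewrite RintegralD//.
rewrite RintegralZr// RintegralZl// cstE => E.
by apply: (addIr (\int[P]_w a (W w) * c2 + c1 * \int[P]_w b (X w) + c1 * c2)); move: E; lra.
Qed.

End pair_independence.

Section union_bound.
Context {dO : measure_display} {Omega : measurableType dO} {R : realType}
  {P : probability Omega R}.

Lemma union_bound (I : finType) (S : I -> set Omega) (e : R) :
  (forall i, measurable (S i)) -> (forall i, (P (S i) <= e%:E)%E) ->
  (P (\bigcup_i S i) <= (#|I|%:R * e)%:E)%E.
Proof.
move=> mS Se.
have mU : measurable (\bigcup_i S i) by apply: fin_bigcup_measurable.
have fI : finite_set [set: I] by [].
have := content_sub_fsum P fI (fun i _ => mS i) mU (fun _ h => h).
move=> /le_trans; apply; rewrite fsbig_finite//=.
apply: (le_trans (lee_sum _ (fun i _ => Se i))).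
rewrite sumEFin lee_fin big_const_seq iter_addr count_predT addr0 -[e *+ _]mulr_natl.
have -> : size (finmap.enum_fset (fset_set [set: I])) = #|I|; last by [].
rewrite cardT; apply/perm_size/uniq_perm; rewrite ?enum_uniq ?finmap.fset_uniq// => i.
rewrite mem_enum [LHS]in_fset_set// [RHS]inE; exact/mem_set.
Qed.

End union_bound.

Section concentration.
Context {dO d1 : measure_display} {Omega : measurableType dO} {T : measurableType d1}
  {R : realType} {P : probability Omega R}.
Context {n M : nat}.
Variables (Z : 'I_n -> {RV P >-> T}) (V : Omega -> T) (L : R).
Hypotheses (n0 : (0 < n)%N) (M2 : (2 <= M)%N) (mV : measurable_fun setT V).
Hypothesis iid : iid_copies P (fun i => Z i : Omega -> T) V.
Hypothesis Lrate : L * @rate R n M <= 8^-1.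
Local Notation rate := (@rate R n M).

Lemma measurable_avg (g : T -> R) : measurable_fun setT g ->
  measurable_fun setT (fun w => avg (fun i => g (Z i w))).
Proof.
move=> mg; apply: measurable_funM => //; apply: measurable_sum => i.
exact: measurableT_comp.
Qed.

(* [L * rate <= 1/8] allows the exponent [3 * rate / sigma] in the Chernoff bound,
   which yields [exp (- 9 ln M)]. *)
Lemma one_sided_deviation (g : T -> R) (m sigma : R) :
  measurable_fun setT g -> 0 < sigma -> (forall x, `|g x| <= sigma * L) ->
  \int[P]_w g (V w) = m -> \int[P]_w (g (V w) ^+ 2) <= sigma ^+ 2 ->
  (P [set w | (m + 6 * sigma * rate <= avg (fun i => g (Z i w)))%R]
     <= (M%:R ^- 9)%:E)%E.
Proof.
move=> mg s0 gL Em Ev.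
have l0 : 0 < rate := rate_gt0 n0 M2.
have n0' : 0 < n%:R :> R by rewrite ltr0n.
have M0 : 0 < M%:R :> R by rewrite ltr0n ltnW.
have rate2 : n%:R * rate ^+ 2 = ln M%:R.
  rewrite sqr_sqrtr ?divr_ge0 ?ln_ge0 ?ler1n// 1?ltnW// mulrC divfK// gt_eqF//.
have -> : M%:R ^- 9 = expR (n%:R * ((3 * rate / sigma) ^+ 2 * sigma ^+ 2
    - 3 * rate / sigma * (6 * sigma * rate))) :> R.
  have -> : n%:R * ((3 * rate / sigma) ^+ 2 * sigma ^+ 2
    - 3 * rate / sigma * (6 * sigma * rate)) = - (9%:R * (n%:R * rate ^+ 2)).
    by field; rewrite gt_eqF.
  by rewrite rate2 expRN expRM_natl lnK// posrE.
apply: (@iid_chernoff _ _ _ _ _ _ _ _ _ _ _ (3 * rate / sigma) m (sigma ^+ 2)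
  (6 * sigma * rate) n0 mV iid mg gL).
- by rewrite divr_ge0 ?mulr_ge0// ltW.
- have -> : 3 * rate / sigma * (sigma * L) = 3 * (L * rate) by field; rewrite gt_eqF.
  have := Lrate.
  lra.
- by rewrite Em.
- exact: Ev.
Qed.

Lemma deviation (g : T -> R) (m sigma : R) :
  measurable_fun setT g -> 0 < sigma -> (forall x, `|g x| <= sigma * L) ->
  \int[P]_w g (V w) = m -> \int[P]_w (g (V w) ^+ 2) <= sigma ^+ 2 ->
  (P [set w | (6 * sigma * rate <= `|avg (fun i => g (Z i w)) - m|)%R]
     <= (2 * M%:R ^- 9)%:E)%E.
Proof.
move=> mg s0 gL Em Ev.
have up := one_sided_deviation mg s0 gL Em Ev.
have mNg : measurable_fun setT (fun x => - g x) by exact: measurableT_comp.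
have NgL x : `|- g x| <= sigma * L by rewrite normrN.
have ig : P.-integrable setT (EFin \o (g \o V)).
  by apply: (integrable_of_bounded _ (fun w => gL (V w))); exact: measurableT_comp.
have EN : \int[P]_w (- g (V w)) = - m.
  by under eq_Rintegral do rewrite -mulN1r; rewrite RintegralZl// mulN1r Em.
have EvN : \int[P]_w ((- g (V w)) ^+ 2) <= sigma ^+ 2.
  by under eq_Rintegral do rewrite sqrrN.
have dn := one_sided_deviation mNg s0 NgL EN EvN.
set U := [set w | _] in up; set D := [set w | _] in dn.
have mge (h : Omega -> R) (c : R) : measurable_fun setT h -> measurable [set w | c <= h w].
  move=> mh; rewrite -[X in measurable X]setTI
    (_ : [set w | _] = h @^-1` `[c, +oo[%classic); first exact: mh.
  by apply/seteqP; split => w /=; rewrite in_itv/= andbT.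
have mU : measurable U by apply: mge; exact: measurable_avg.
have mD : measurable D by apply: mge; exact: (measurable_avg mNg).
have -> : [set w | 6 * sigma * rate <= `|avg (fun i => g (Z i w)) - m|] = U `|` D.
  apply/seteqP; split => w; rewrite /U /D /= ler_normr.
    move=> /orP[h|h]; [left; lra|right].
    have -> : avg (fun i => - g (Z i w)) = - avg (fun i => g (Z i w)).
      by rewrite -mulN1r avgZ; apply: eq_avg => i; rewrite mulN1r.
    lra.
  have -> : avg (fun i => - g (Z i w)) = - avg (fun i => g (Z i w)).
    by rewrite -mulN1r avgZ; apply: eq_avg => i; rewrite mulN1r.
  by move=> [h|h]; apply/orP; [left|right]; lra.
apply: (le_trans (measureU2 P mU mD)).
by rewrite mulrDl mul1r EFinD leeD.
Qed.

Lemma measurable_deviation (g : T -> R) (m c : R) : measurable_fun setT g ->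
  measurable [set w | c <= `|avg (fun i => g (Z i w)) - m|].
Proof.
move=> mg; rewrite -[X in measurable X]setTI
  (_ : [set w | _] = (fun w => `|avg (fun i => g (Z i w)) - m|) @^-1` `[c, +oo[%classic).
  have mh : measurable_fun setT (fun w => `|avg (fun i => g (Z i w)) - m|).
    apply: measurableT_comp => //; apply: measurable_funB => //; exact: measurable_avg.
  exact: mh.
by apply/seteqP; split => w /=; rewrite in_itv/= andbT.
Qed.

End concentration.

Section interval_probability.
Context {dO : measure_display} {Omega : measurableType dO} {R : realType}
  {P : probability Omega R}.

Lemma Rintegral_bool (b : Omega -> bool) : measurable [set w | b w] ->
  \int[P]_w (b w)%:R = fine (P [set w | b w]) :> R.
Proof.
move=> mb; rewrite /Rintegral; congr fine.
rewrite -[RHS](_ : (\int[P]_w (\1_[set w | b w] w)%:E = _)%E); last first.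
  by rewrite integral_indic// setIT.
apply: eq_integral => w _; rewrite indicE; congr ((nat_of_bool _)%:R%:E).
by apply/idP/idP => [h|/set_mem//]; exact/mem_set.
Qed.

Lemma interval_prob (W : {RV P >-> R}) (a b : R) :
  1.-lipschitz (fun t : R => fine (cdf W t)) -> a <= b ->
  fine (P [set w | a <= W w <= b]) <= b - a.
Proof.
move=> lip ab; apply/ler_addgt0Pr => e e0.
have mle c : measurable [set w | W w <= c].
  rewrite -[X in measurable X]setTI (_ : [set w | _] = W @^-1` `]-oo, c]%classic).
    exact: measurable_funPT.
  by apply/seteqP; split => w /=; rewrite in_itv.
have cdfE c : cdf W c = P [set w | W w <= c].
  by rewrite /cdf /distribution /pushforward; congr (P _); apply/seteqP; split => w /=; rewrite in_itv.
have mI : measurable [set w | a <= W w <= b].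
  rewrite -[X in measurable X]setTI (_ : [set w | _] = W @^-1` `[a, b]%classic).
    exact: measurable_funPT.
  by apply/seteqP; split => w /=; rewrite in_itv.
(* The c.d.f. measures half-open intervals; starting at [a - e] includes the left endpoint [a], at
   an extra cost [e]. *)
have : (P [set w | (a <= W w <= b)%R] + P [set w | (W w <= a - e)%R] <= P [set w | (W w <= b)%R])%E.
  rewrite -measureU//; last first.
    apply/seteqP; split => w //= -[/andP[h1 _] h2]; lra.
  apply: le_measure; rewrite ?inE//; first exact: measurableU.
  by move=> w /= [/andP[]//|h]; lra.
have fin A : measurable A -> P A \is a fin_num by move=> mA; rewrite fin_num_measure.
rewrite -(fineK (fin _ mI)) -(fineK (fin _ (mle (a - e)))) -(fineK (fin _ (mle b))).
rewrite -EFinD lee_fin.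
have := lip (b, a - e) (conj I I); rewrite /= !cdfE.
rewrite ler_norml mul1r => /andP[_].
have -> : `|b - (a - e)| = b - (a - e) by rewrite ger0_norm//; lra.
lra.
Qed.

End interval_probability.

(** * First and second moments of the controlled averages *)

Section moments.
Context {R : realType} {d M : nat} {dO : measure_display} {Omega : measurableType dO}
  {P : probability Omega R}.
Variables (K alpha L : R).
Variable X : {RV P >-> d.-tuple R}.
Variable W : {RV P >-> R}.
Variable f : 'I_M -> {mfun d.-tuple R >-> R}.
Variable thetas : 'rV[R]_M.
Variable G : set (d.-tuple R).
Hypotheses (K0 : 0 < K) (alpha0 : 0 < alpha) (L0 : 0 <= L).
Hypothesis indep : independent_rv P X W.
Hypothesis sym : symmetric_rv P W.
Hypothesis lip : 1.-lipschitz (fun t : R => fine (cdf W t)).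
Hypotheses (mG : measurable G) (PG : P (X @^-1` ~` G) = 0%E).
Hypothesis GL : forall x, G x -> forall j, `|f j x| <= L.
Hypothesis Gram1 : forall j, Gram f X j j = 1.
Local Notation B := (2 * K + alpha).

Let B0 : 0 <= B.
Proof. by rewrite addr_ge0 ?mulr_ge0// ltW. Qed.

(* The dictionary is only essentially bounded; [tf] is bounded everywhere and
   almost surely equal to it. *)
Definition tf (j : 'I_M) (x : d.-tuple R) : R := f j x * \1_G x.

Definition residual (z : d.-tuple R * R) : R := z.2 - lincomb f thetas z.1.

Lemma tfE j x : G x -> tf j x = f j x.
Proof. by move=> Gx; rewrite /tf indicE mem_set// mulr1. Qed.

Lemma tf_le j x : `|tf j x| <= L.
Proof.
have [Gx|Gx] := pselect (G x); first by rewrite tfE//; exact: GL.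
by rewrite /tf indicE memNset// mulr0 normr0.
Qed.

Lemma measurable_tf j : measurable_fun setT (tf j).
Proof. by apply: measurable_funM => //; exact: measurable_indic. Qed.

Lemma measurable_residual : measurable_fun setT residual.
Proof.
apply: measurable_funB; first exact: measurable_snd.
by apply: measurableT_comp measurable_fst; exact: measurable_lincomb.
Qed.

Lemma measurable_le_bool (d1 : measure_display) (T : measurableType d1) (h : T -> R) (c : R) :
  measurable_fun setT h -> measurable_fun setT (fun x => (h x <= c)%R%:R : R).
Proof.
move=> mh; have -> : (fun x => (h x <= c)%R%:R) = \1_(h @^-1` `]-oo, c]%classic) :> (T -> R).
  apply/funext => x; rewrite indicE; congr ((nat_of_bool _)%:R).
  by apply/idP/idP => [hc|/set_mem]; [apply/mem_set|]; rewrite /= in_itv.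
by apply: measurable_indic; rewrite -[X in measurable X]setTI; exact: mh.
Qed.

Let mclamp : measurable_fun setT (@clamp R B).
Proof. by apply: continuous_measurable_fun; exact: continuous_clamp. Qed.

Let mX (b : d.-tuple R -> R) : measurable_fun setT b -> measurable_fun setT (b \o X).
Proof. by move=> mb; exact: measurableT_comp. Qed.

Let mW (b : R -> R) : measurable_fun setT b -> measurable_fun setT (b \o W).
Proof. by move=> mb; exact: measurableT_comp. Qed.

Lemma expectation_tf j k : \int[P]_w (tf j (X w) * tf k (X w)) = Gram f X j k.
Proof.
rewrite mxE unlock /Rintegral; congr fine.
apply: ae_eq_integral => //.
- by apply/measurable_EFinP/measurable_funM; apply: mX; exact: measurable_tf.
- by apply/measurable_EFinP/measurable_funM; apply: mX.
exists (X @^-1` ~` G); split => //.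
  rewrite -[X in measurable X]setTI; apply: measurable_funPT => //; exact: measurableC.
move=> w /= h Gw; apply: h => _; by rewrite !tfE.
Qed.

Let itf j k : P.-integrable setT (EFin \o (fun w => tf j (X w) * tf k (X w))).
Proof.
apply: (@integrable_of_bounded _ _ _ _ _ (L * L)).
  by apply: measurable_funM; apply: mX; exact: measurable_tf.
by move=> w; rewrite normrM; apply: ler_pM => //; exact: tf_le.
Qed.

(** [1] is the second moment of [tf j (X)], which is at most [L ^+ 2]. The numerical estimates
    compare powers of [L] through this. *)
Lemma L_ge1 : (0 < M)%N -> 1 <= L.
Proof.
move=> M0; pose j := Ordinal M0.
rewrite -(@ler_pXn2r _ 2)// ?nnegrE// expr1n -(Gram1 j) -expectation_tf.
have -> : L ^+ 2 = \int[P]_w (fun=> L ^+ 2) w.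
  rewrite Rintegral_cst//.
  by rewrite [X in _ * X](_ : _ = 1) ?mulr1//; exact: (congr1 fine (probability_setT P)).
apply: le_Rintegral => //.
  by apply: (@integrable_of_bounded _ _ _ _ _ `|L ^+ 2|).
move=> w _; rewrite -expr2 -real_normK ?num_real// ler_pXn2r ?nnegrE//. exact: tf_le.
Qed.

(** Only [a] is bounded pointwise; the square of [tf j] is integrated to 1. The result is [c ^+ 2]
    instead of [(c * L) ^+ 2], so the deviation scale is free of [L]. *)
Let sq_bound (a : R -> R) (c : R) j : measurable_fun setT a -> 0 <= c ->
  (forall x, `|a x| <= c) -> \int[P]_w ((a (W w) * tf j (X w)) ^+ 2) <= c ^+ 2.
Proof.
move=> ma c0 ac.
have -> : c ^+ 2 = \int[P]_w (c ^+ 2 * (tf j (X w) * tf j (X w))).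
  by rewrite RintegralZl// expectation_tf Gram1 mulr1.
have mat : measurable_fun setT (fun w => (a (W w) * tf j (X w)) ^+ 2).
  apply: measurable_funX; apply: measurable_funM; first exact: (mW ma).
  exact: (mX (measurable_tf j)).
apply: le_Rintegral => //.
- apply: (@integrable_of_bounded _ _ _ _ _ ((c * L) ^+ 2)) => // w.
  rewrite normrX ler_pXn2r ?nnegrE ?mulr_ge0// normrM; apply: ler_pM => //; exact: tf_le.
- exact: (integrableZl measurableT (c ^+ 2) (itf j j)).
- move=> w _; rewrite exprMn -[tf j _ * tf j _]expr2 ler_wpM2r ?sqr_ge0//.
  by rewrite -[leLHS]real_normK ?num_real// ler_pXn2r ?nnegrE.
Qed.

Lemma clamp_centered : \int[P]_w clamp B (W w) = 0.
Proof.
have mNW : measurable_fun setT (fun w => - W w) by exact: measurableT_comp.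
have ic (U : Omega -> R) : measurable_fun setT U ->
    P.-integrable setT (EFin \o (fun w => clamp B (U w))).
  move=> mU; apply: (@integrable_of_bounded _ _ _ _ _ B) => [|w]; last exact: clamp_norm.
  exact: measurableT_comp.
have icst : P.-integrable setT (EFin \o (fun=> B)).
  by apply: (@integrable_of_bounded _ _ _ _ _ `|B|).
(* The shift by [B] makes the integrand nonnegative, as the transfer between equal laws requires;
   oddness of [clamp] then gives mean zero. *)
have : \int[P]_w (clamp B (W w) + B) = \int[P]_w (clamp B (- W w) + B).
  rewrite /Rintegral; congr fine.
  apply: (same_law_ge0_integral (g := fun x => clamp B x + B) _ mNW sym) => //.
    exact: measurable_funD.
  move=> x; have := clamp_norm x B0; rewrite ler_norml => /andP[? _]; lra.
have iW : P.-integrable setT (EFin \o (fun w => clamp B (W w))) by exact: ic.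
have iNW : P.-integrable setT (EFin \o (fun w => clamp B (- W w))) by exact: ic.
rewrite (RintegralD measurableT iW icst) (RintegralD measurableT iNW icst) => E.
have EN : \int[P]_w clamp B (- W w) = - \int[P]_w clamp B (W w).
  under eq_Rintegral do rewrite clampN// -mulN1r.
  by rewrite RintegralZl ?mulN1r.
lra.
Qed.

Lemma expectation_score j : \int[P]_w (clamp B (W w) * tf j (X w)) = 0.
Proof.
rewrite (expectation_mul_indep indep mclamp (measurable_tf j)
  (fun x => clamp_norm x B0) (tf_le j)).
by rewrite clamp_centered mul0r.
Qed.

Lemma second_moment_score j : \int[P]_w ((clamp B (W w) * tf j (X w)) ^+ 2) <= B ^+ 2.
Proof. by apply: sq_bound => // x; exact: clamp_norm. Qed.

Let mabs (a : R) : measurable_fun setT (fun x : R => (`|x| <= a)%R%:R : R).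
Proof. exact: measurable_le_bool. Qed.

Let bool_norm (b : bool) : `|b%:R : R| <= 1.
Proof. by case: b; rewrite ?normr1 ?normr0. Qed.

Lemma measurable_abs_le (a : R) : measurable [set w | `|W w| <= a].
Proof.
have mN : measurable_fun setT (fun w => `|W w|) by exact: measurableT_comp.
rewrite -[X in measurable X]setTI
  (_ : [set w | _] = (fun w => `|W w|) @^-1` `]-oo, a]%classic); first exact: mN.
by apply/seteqP; split => w /=; rewrite in_itv.
Qed.

Lemma prob_abs_leE a : \int[P]_w (`|W w| <= a)%R%:R = prob_abs_le P W a.
Proof. by rewrite Rintegral_bool//; exact: measurable_abs_le. Qed.

Lemma expectation_wgram a j k :
  \int[P]_w ((`|W w| <= a)%R%:R * (tf j (X w) * tf k (X w)))
    = prob_abs_le P W a * Gram f X j k.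
Proof.
rewrite (@expectation_mul_indep _ _ _ _ _ _ X W indep (fun x : R => (`|x| <= a)%R%:R)
  (fun x => tf j x * tf k x) 1 (L * L))//.
- by rewrite prob_abs_leE expectation_tf.
- by apply: measurable_funM; exact: measurable_tf.
- by move=> x; rewrite normrM; apply: ler_pM => //; exact: tf_le.
Qed.

Lemma second_moment_wgram a j k :
  \int[P]_w (((`|W w| <= a)%R%:R * (tf j (X w) * tf k (X w))) ^+ 2) <= L ^+ 2.
Proof.
have -> : L ^+ 2 = \int[P]_w (L ^+ 2 * (tf k (X w) * tf k (X w))).
  by rewrite RintegralZl// expectation_tf Gram1 mulr1.
have mt : measurable_fun setT (fun w => ((`|W w| <= a)%R%:R * (tf j (X w) * tf k (X w))) ^+ 2).
  apply: measurable_funX; apply: measurable_funM; first exact: (mW (mabs a)).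
  by apply: measurable_funM; apply: mX; exact: measurable_tf.
have le1 w : ((`|W w| <= a)%R%:R * (tf j (X w) * tf k (X w))) ^+ 2
    <= L ^+ 2 * (tf k (X w) * tf k (X w)).
  have h1 : tf j (X w) ^+ 2 <= L ^+ 2.
    by rewrite -[leLHS]real_normK ?num_real// ler_pXn2r ?nnegrE//; exact: tf_le.
  case: (`|W w| <= a); rewrite ?mul1r ?mul0r -?[tf k _ * tf k _]expr2.
    by rewrite exprMn ler_wpM2r ?sqr_ge0.
  by rewrite expr0n/= mulr_ge0 ?sqr_ge0.
apply: le_Rintegral => //.
- apply: (@integrable_of_bounded _ _ _ _ _ (L ^+ 2 * (L * L))) => // w.
  rewrite ger0_norm ?sqr_ge0// (le_trans (le1 w))// ler_wpM2l ?sqr_ge0//.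
  by apply: (le_trans (ler_norm _)); rewrite normrM; apply: ler_pM => //; exact: tf_le.
- exact: (integrableZl measurableT (L ^+ 2) (itf k k)).
Qed.

(** At [a = 2 * K + alpha] this is the hypothesis [qB] of the numerical estimates. *)
Lemma prob_abs_le_le a : 0 <= a -> prob_abs_le P W a <= 2 * a.
Proof.
move=> a0; rewrite /prob_abs_le.
have -> : [set w | `|W w| <= a] = [set w | - a <= W w <= a].
  by apply/seteqP; split => w /=; rewrite ler_norml.
by apply: (le_trans (interval_prob lip _)); lra.
Qed.

Let mnear (t : R) : measurable_fun setT (fun x : R => (`| `|x| - B| <= t)%R%:R : R).
Proof.
apply: (@measurable_le_bool _ _ (fun x : R => `| `|x| - B|)).
by apply: measurableT_comp => //; exact: measurable_funB.
Qed.

(** The band is covered by two intervals of length [2 * t], around [B] and [- B]. *)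
Lemma expectation_near t : 0 <= t ->
  \int[P]_w (`| `|W w| - B| <= t)%R%:R <= 4 * t.
Proof.
move=> t0.
have mI a b : measurable [set w | a <= W w <= b].
  rewrite -[X in measurable X]setTI (_ : [set w | _] = W @^-1` `[a, b]%classic).
    exact: measurable_funPT.
  by apply/seteqP; split => w /=; rewrite in_itv.
have ib a b : P.-integrable setT (EFin \o (fun w => (a <= W w <= b)%R%:R : R)).
  have -> : (fun w => (a <= W w <= b)%R%:R : R) = \1_[set w | a <= W w <= b].
    apply/funext => w; rewrite indicE; congr ((nat_of_bool _)%:R).
    by apply/idP/idP => [h|/set_mem//]; exact/mem_set.
  exact: integrable_indic.
apply: (@le_trans _ _ (\int[P]_w ((B - t <= W w <= B + t)%R%:R + (- B - t <= W w <= - B + t)%R%:R))).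
  apply: le_Rintegral => //.
  - apply: (@integrable_of_bounded _ _ _ _ _ 1) => //; exact: (mW (mnear t)).
  - exact: (integrableD measurableT (ib _ _) (ib _ _)).
  move=> w _; case: (boolP (`| `|W w| - B| <= t)) => [|_]; last by rewrite addr_ge0.
  rewrite ler_norml => /andP[h1 h2].
  case: (ger0P (W w)) h1 h2 => w0 h1 h2.
    have -> : (B - t <= W w <= B + t) by apply/andP; split; lra.
    by rewrite lerDl.
  have -> : (- B - t <= W w <= - B + t) by apply/andP; split; lra.
  by rewrite lerDr.
rewrite RintegralD// !Rintegral_bool//.
have h1 := @interval_prob _ _ _ _ W (B - t) (B + t) lip.
have h2 := @interval_prob _ _ _ _ W (- B - t) (- B + t) lip.
have := h1 ltac:(lra); have := h2 ltac:(lra); lra.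
Qed.

Lemma second_moment_near t : \int[P]_w ((`| `|W w| - B| <= t)%R%:R ^+ 2) <= 1 ^+ 2 :> R.
Proof.
have -> : 1 ^+ 2 = \int[P]_w (fun=> 1) w :> R.
  rewrite Rintegral_cst// expr1n.
  by rewrite [X in _ * X](_ : _ = 1) ?mulr1//; exact: (congr1 fine (probability_setT P)).
apply: le_Rintegral => //.
- apply: (@integrable_of_bounded _ _ _ _ _ 1) => [|w].
    by apply: measurable_funX; exact: (mW (mnear t)).
  by rewrite normrX exprn_ile1.
- by apply: (@integrable_of_bounded _ _ _ _ _ 1) => // w; rewrite normr1.
- by move=> w _; case: (_ <= t); rewrite ?expr1n// expr0n.
Qed.

End moments.

(** * The good event as a finite union bound *)

Section good_event.
Context {R : realType} {d n M : nat} {dO : measure_display} {Omega : measurableType dO}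
  {P : probability Omega R}.
Variables (K alpha L tau : R).
Variable X : {RV P >-> d.-tuple R}.
Variable W : {RV P >-> R}.
Variable f : 'I_M -> {mfun d.-tuple R >-> R}.
Variable thetas : 'rV[R]_M.
Variable Z : 'I_n -> {RV P >-> (d.-tuple R * R)%type}.
Variable G : set (d.-tuple R).
Hypotheses (n0 : (0 < n)%N) (M2 : (2 <= M)%N).
Hypotheses (K0 : 0 < K) (alpha0 : 0 < alpha) (L0 : 0 <= L) (tau0 : 0 <= tau).
Hypothesis indep : independent_rv P X W.
Hypothesis sym : symmetric_rv P W.
Hypothesis iid : iid_copies P (fun i => Z i : Omega -> _)
  (fun w => (X w, lincomb f thetas (X w) + W w)).
Hypothesis lip : 1.-lipschitz (fun t : R => fine (cdf W t)).
Hypotheses (mG : measurable G) (PG : P (X @^-1` ~` G) = 0%E).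
Hypothesis GL : forall x, G x -> forall j, `|f j x| <= L.
Hypothesis Gram1 : forall j, Gram f X j j = 1.
Hypothesis Lrate : L * @rate R n M <= 8^-1.
Local Notation B := (2 * K + alpha).
Local Notation rate := (@rate R n M).
Local Notation ttf := (tf f G).
Local Notation res := (residual f thetas).
Let V w := (X w, lincomb f thetas (X w) + W w).

Let B0 : 0 < B.
Proof. by rewrite addr_gt0 ?mulr_gt0. Qed.

Let L1 : 1 <= L.
Proof. by apply: (L_ge1 L0 mG PG GL Gram1); exact: ltnW. Qed.

Let mV : measurable_fun setT V.
Proof.
apply/measurable_fun_pairP; split => //=; apply: measurable_funD => //.
by apply: measurableT_comp => //; exact: measurable_lincomb.
Qed.

Let residualV w : res (V w) = W w.
Proof. by rewrite /residual /= addrAC subrr add0r. Qed.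

(** One index type for all averages, so that a single union bound suffices: [M] scores, the Gram
    entries at level [alpha] ([true]) or [B] ([false]), and the band indicator. *)
Let I : finType := ('I_M + ('I_M * 'I_M * bool) + unit)%type.

Let level (b : bool) : R := if b then alpha else B.

Let test (i : I) : d.-tuple R * R -> R := match i with
  | inl (inl j) => fun z => clamp B (res z) * ttf j z.1
  | inl (inr (j, k, b)) => fun z => (`|res z| <= level b)%R%:R * (ttf j z.1 * ttf k z.1)
  | inr _ => fun z => (`| `|res z| - B| <= tau)%R%:R
  end.

(** Chosen so that a test is bounded by [scale * L] with second moment at most [scale ^+ 2], as
    [deviation] requires. *)
Let scale (i : I) : R := match i with
  | inl (inl _) => B | inl (inr _) => L | inr _ => 1 end.

Let mean (i : I) : R := \int[P]_w test i (V w).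

Let mres : measurable_fun setT res := measurable_residual f thetas.

Let mtf j : measurable_fun setT (fun z : d.-tuple R * R => ttf j z.1).
Proof.
have := @measurable_tf R d M f G mG j => h.
by apply: measurableT_comp h measurable_fst.
Qed.

Let mtest i : measurable_fun setT (test i).
Proof.
case: i => [[j|[[j k] b]]|u] /=.
- apply: measurable_funM => //; apply: measurableT_comp mres.
  by apply: continuous_measurable_fun; exact: continuous_clamp.
- apply: measurable_funM; last exact: measurable_funM.
  apply: (@measurable_le_bool _ _ _ (fun z => `|res z|)).
  exact: measurableT_comp.
- apply: (@measurable_le_bool _ _ _ (fun z => `| `|res z| - B|)).
  apply: measurableT_comp => //; apply: measurable_funB => //; exact: measurableT_comp.
Qed.

Let scale_gt0 i : 0 < scale i.
Proof. by case: i => [[j|[[j k] b]]|u] //=; exact: lt_le_trans L1. Qed.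

Let test_le i z : `|test i z| <= scale i * L.
Proof.
have tfL j x : `|ttf j x| <= L by exact: tf_le.
have bool_le (b : bool) : `|b%:R : R| <= 1 by case: b; rewrite ?normr1 ?normr0.
case: i => [[j|[[j k] b]]|u] /=.
- by rewrite normrM ler_pM//; exact: clamp_norm (ltW B0).
- rewrite normrM -[leRHS]mul1r ler_pM// normrM; exact: ler_pM.
- by rewrite mul1r (le_trans (bool_le _)).
Qed.

Let test_sq i : \int[P]_w (test i (V w) ^+ 2) <= scale i ^+ 2.
Proof.
case: i => [[j|[[j k] b]]|u] /=.
- under eq_Rintegral do rewrite residualV.
  exact: (second_moment_score W K0 alpha0 L0 mG PG GL Gram1 j).
- under eq_Rintegral do rewrite residualV.
  exact: (second_moment_wgram W L0 mG PG GL Gram1).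
- under eq_Rintegral do rewrite residualV.
  exact: second_moment_near.
Qed.

Lemma good_event : exists S : set Omega, [/\ measurable S,
  (P (~` S) <= (M%:R^-1)%:E)%E &
  forall w, S w -> [/\ forall i, G (Z i w).1,
   forall j, `|avg (fun i => clamp B (res (Z i w)) * f j (Z i w).1)| <= 6 * B * rate,
   forall a j k, a \in [:: alpha; B] ->
     `|wgram (fun i j => f j (Z i w).1) (fun i => res (Z i w)) a j k
       - prob_abs_le P W a * Gram f X j k| <= 6 * L * rate &
   avg (fun i => (`| `|res (Z i w)| - B| <= tau)%R%:R) <= 4 * tau + 6 * rate]].
Proof.
pose bad (i : I) := [set w | (6 * scale i * rate <= `|avg (fun l => test i (Z l w)) - mean i|)%R].
pose Gc : set (d.-tuple R * R)%type := [set z | ~ G z.1].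
pose out (i : 'I_n) := Z i @^-1` Gc.
have mbad i : measurable (bad i) by apply: measurable_deviation.
have mGc : measurable Gc.
  rewrite -[Gc]setTI.
  have := @measurable_fst _ _ (d.-tuple R) R measurableT (~` G) (measurableC mG).
  exact.
have mout i : measurable (out i).
  by rewrite -[X in measurable X]setTI; exact: measurable_funPT.
have Pbad i : (P (bad i) <= (2 * M%:R ^- 9)%:E)%E.
  by apply: (deviation n0 M2 mV iid Lrate).
(* A sample point has the law of [V], whose first component is [X], so it leaves [G] with
   probability zero; on [G] the truncated and original dictionaries agree. *)
have Pout i : (P (out i) <= 0%:E)%E.
  have -> : P (out i) = P (V @^-1` Gc) by exact: iid.2.
  by have -> : P (V @^-1` Gc) = 0%E := PG.
have mB : measurable (\bigcup_i bad i) by apply: fin_bigcup_measurable.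
have mO : measurable (\bigcup_i out i) by apply: fin_bigcup_measurable.
exists (~` (\bigcup_i bad i `|` \bigcup_i out i)); split.
- exact/measurableC/measurableU.
- rewrite setCK; apply: (le_trans (measureU2 P mB mO)).
  apply: (le_trans (leeD (union_bound mbad Pbad) (union_bound mout Pout))).
  rewrite mulr0 adde0 lee_fin !card_sum !card_prod card_bool card_unit !card_ord.
  have M0 : 0 < M%:R :> R by rewrite ltr0n ltnW.
  (* With [M + 2 M^2 + 1] tests failing with probability at most [2 / M^9] each, it remains to show
     [2 (M + 2 M^2 + 1) <= M^8], which follows from [M^6 >= 64]. *)
  rewrite mulrA ler_pdivrMr ?exprn_gt0// exprS mulKf ?gt_eqF//.
  rewrite -natrX -[2]/(2%:R) -natrM ler_nat.
  have h1 : (2 ^ 6 <= M ^ 6)%N by rewrite leq_exp2r.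
  have h2 : (M * M * 2 ^ 6 <= M ^ 8)%N by rewrite (expnS M 7) (expnS M 6) mulnA leq_mul2l h1 orbT.
  have h3 : (2 * M <= M * M)%N by rewrite leq_mul2r M2 orbT.
  lia.
move=> w /not_orP[nbad nout].
have GZ i : G (Z i w).1 by apply: contrapT => h; apply: nout; exists i.
have close i : `|avg (fun l => test i (Z l w)) - mean i| <= 6 * scale i * rate.
  by rewrite leNgt; apply/negP => h; apply: nbad; exists i => //; exact: ltW.
split=> //.
- move=> j; have := close (inl (inl j)).
  rewrite /mean /=; under eq_Rintegral do rewrite residualV.
  rewrite (expectation_score K0 alpha0 L0 indep sym mG GL) subr0.
  by congr (`|_| <= _); apply: eq_avg => i; rewrite tfE.
- move=> a j k aE.
  have [b ->] : exists b, a = level b.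
    by move: aE; rewrite !inE => /orP[/eqP ->|/eqP ->]; [exists true|exists false].
  have := close (inl (inr (j, k, b))).
  rewrite /mean /=; under eq_Rintegral do rewrite residualV.
  rewrite (expectation_wgram L0 indep mG PG GL).
  by congr (`|_ - _| <= _); apply: eq_avg => i; rewrite !tfE.
- have := close (inr tt); rewrite /mean /=; under eq_Rintegral do rewrite residualV.
  rewrite ler_norml => /andP[_]; rewrite mulr1.
  have := expectation_near K alpha lip tau0.
  lra.
Qed.

End good_event.

Theorem theorem3 (R : realType) (dO : measure_display)
  (Omega : measurableType dO) (P : probability Omega R)
  (d n M s : nat) (K alpha L beta : R)
  (X : {RV P >-> d.-tuple R}) (W : {RV P >-> R})
  (f : 'I_M -> {mfun d.-tuple R >-> R}) (thetas : 'rV[R]_M)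
  (Z : 'I_n -> {RV P >-> (d.-tuple R * R)%type}) :
  let Y := fun w => lincomb f thetas (X w) + W w in
  let p := prob_abs_le P W alpha in
  let q := prob_abs_le P W (2 * K + alpha) in
  let rt := rtilde L n M in
  let r := rpar K alpha L n M in
  let c2 := C2 K L beta p s in
  let c4 := C4 K L beta p q n s in
  let G := Gram f X in
  (0 < n)%N -> (2 <= M)%N -> (1 <= s)%N ->
  0 < K -> 0 < alpha -> 0 < L -> 1 < beta ->
  independent_rv P X W ->
  symmetric_rv P W ->
  iid_copies P Z (fun w => (X w, Y w)) ->
  (forall j, norm_2 X (f j) = 1%E) ->
  (forall j, (norm_infty X (f j) <= L%:E)%E) ->
  rt <= 1 ->
  0 < p ->
  (norm_infty X (lincomb f thetas) <= K%:E)%E ->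
  (forall j, G j j = 1) ->
  (forall j k, j != k -> `|G j k| <= (3 * beta * s%:R)^-1) ->
  1.-lipschitz (fun t : R => fine (cdf W t)) ->
  s%:R <= (Num.sqrt r)^-1 ->
  12 * L ^+ 3 * eta_par K alpha L beta p n M s + L * rt
    + c2 / (Num.sqrt n%:R * s%:R ^+ 2) <= q / 2 ->
  ((2 * c4 * r)%:E < min_abs_supp thetas)%E ->
  (#|supp thetas| <= s)%N ->
  ((1 - M%:R^-1 - M%:R `^ (- K) - expR (- Num.sqrt (ln M%:R))
    - 3 * M%:R `^ (- (2 * K)) * ln (n%:R / ln M%:R))%:E
   <= P [set w | forall ttheta : 'rV[R]_M,
           Theta_tilde K alpha f X r (c4 * r) (fun i => Z i w) ttheta ->
           sign_vec ttheta = sign_vec thetas])%E.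
Proof.
move=> Y p q rt r c2 c4 G0 n0 M2 s1 K0 a0 L0 b1 indep sym iid _ fL _ p0 Ts G1 mu lip
  sr small rho Ms.
have [G [mG PG GX]] := good_points K fL.
have GL x : G x -> forall j, `|f j x| <= L by move=> /GX[].
have L1 : 1 <= L by apply: (L_ge1 (ltW L0) mG PG GL G1); exact: ltnW.
have B0 : 0 < 2 * K + alpha by rewrite addr_gt0 ?mulr_gt0.
have prob1 a : prob_abs_le P W a <= 1.
  rewrite -lee_fin fineK ?fin_num_measure//; last exact: measurable_abs_le.
  by apply: probability_le1; exact: measurable_abs_le.
have pq : p <= q.
  rewrite fine_le ?fin_num_measure//; [exact: measurable_abs_le|exact: measurable_abs_le|].
  apply: le_measure; rewrite ?inE; [exact: measurable_abs_le|exact: measurable_abs_le|].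
  by move=> w /= h; lra.
have q0 : 0 < q := lt_le_trans p0 pq.
have qB : q <= 2 * (2 * K + alpha) := prob_abs_le_le lip (ltW B0).
have r0 : 0 < r := rpar_gt0 n0 M2 K0 a0 L1.
have Lrate := rate_small n0 M2 K0 a0 L1 b1 p0 (prob1 _) q0 (prob1 _) qB small.
have rat0 : 0 < @rate R n M := rate_gt0 n0 M2.
have R0 : 0 <= l1_radius K alpha L beta p n M s.
  (* The value [x = 0] shows that the radius is nonnegative. *)
  apply: (l1_radius_ge n0 M2 s1 K0 a0 L1 b1 p0 (prob1 _) q0 (prob1 _) qB small).
  by rewrite mul0r; rewrite -/r; lra.
have tau0 : 0 <= L * l1_radius K alpha L beta p n M s by rewrite mulr_ge0// ltW.
have c4r0 : 0 <= c4 * r.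
  rewrite -(pmulr_rge0 _ q0).
  apply: le_trans (sup_radius n0 M2 s1 K0 a0 L1 b1 p0 (prob1 _) q0 (prob1 _) qB sr small).
  have coh0 : 0 <= coherence beta s by rewrite invr_ge0 !mulr_ge0//; lra.
  apply: addr_ge0; first by apply: mulr_ge0 => //; exact: ltW.
  apply: mulr_ge0 => //; apply: addr_ge0.
    apply: addr_ge0; first by apply: mulr_ge0 => //; exact: (ltW q0).
    by apply: mulr_ge0; [apply: mulr_ge0; [exact: ler0n|exact: ltW]|exact: (ltW rat0)].
  by apply: mulr_ge0; [exact: sqr_ge0|lra].
have [S [mS PS HS]] := good_event n0 M2 K0 a0 (ltW L0) tau0 indep sym iid lip mG PG GL G1 Lrate.
set T := [set w | _].
have mT : measurable T := measurable_sign_recovery K0 a0 X f Z thetas (ltW r0) c4r0.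
have gram_le a j k : 0 <= a ->
    `|a * Gram f X j k - a *+ (j == k)| <= a * coherence beta s.
  move=> a0'; rewrite -mulr_natr -mulrBr normrM ger0_norm// ler_wpM2l//.
  have [->|jk] := eqVneq j k; last by rewrite subr0; exact: mu.
  by rewrite G1 subrr normr0 invr_ge0 !mulr_ge0//; lra.
have ST : S `<=` T.
  move=> w /HS[GZ Hs Hg Ht].
  have Hg' a j k : a \in [:: alpha; 2 * K + alpha] ->
      `|wgram (fun i j => f j (Z i w).1) (fun i => residual f thetas (Z i w)) a j k
        - prob_abs_le P W a *+ (j == k)|
        <= prob_abs_le P W a * coherence beta s + 6 * L * rate n M.
    move=> aE; rewrite -(subrKA (prob_abs_le P W a * Gram f X j k)) [leRHS]addrC.
    apply: (le_trans (ler_normD _ _)); apply: lerD; first exact: Hg.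
    by apply: gram_le; rewrite fine_ge0.
  apply: (sign_recovery n0 M2 s1 K0 a0 L1 b1 p0 (prob1 _) q0 (prob1 _) qB sr small rho Ms Ts) => //.
  - by move=> i j; exact: GL.
  - by move=> i theta; apply: (GX _ (GZ i)).2.
  - by move=> j k; apply: Hg'; rewrite inE eqxx.
  - by move=> j k; apply: Hg'; rewrite !inE eqxx orbT.
have PST : (P S <= P T)%E by apply: le_measure; rewrite ?inE.
apply: le_trans PST.
have fS : P (~` S) \is a fin_num by rewrite fin_num_measure//; exact: measurableC.
rewrite -[S]setCK probability_setC; last exact: measurableC.
rewrite -(fineK fS) -EFinB lee_fin; move: PS; rewrite -(fineK fS) lee_fin => PS.
(* [rate ^+ 2] is [ln M / n], and [rate <= L * rate <= 1/8], so [n / ln M] is at least 1 and the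
   last subtracted term is nonnegative. *)
have ln0 : 0 <= ln (n%:R / ln M%:R) :> R.
  apply: ln_ge0; rewrite -[leRHS]invrK invf_div invf_ge1; last first.
    by rewrite divr_gt0 ?ln_gt0 ?ltr0n// ltr1n.
  have -> : ln M%:R / n%:R = rate n M ^+ 2 :> R.
    by rewrite sqr_sqrtr// divr_ge0// ln_ge0// ler1n ltnW.
  rewrite expr_le1 ?(ltW rat0)//.
  have : rate n M <= L * rate n M :> R by rewrite ler_peMl// ltW.
  lra.
have h1 : 0 <= M%:R `^ (- K) :> R by exact: powR_ge0.
have h2 : 0 <= expR (- Num.sqrt (ln M%:R)) :> R by exact: expR_ge0.
have h3 : 0 <= 3 * M%:R `^ (- (2 * K)) * ln (n%:R / ln M%:R) :> R.
  by rewrite mulr_ge0// mulr_ge0// powR_ge0.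
lra.
Qed.
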